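(* Let $d\ge2$, let $\{u_i,i\ge1\}$ be a sequence of unit vectors in $\mathbb R^d$, and fix $p\in[1,\infty)$, $\Gamma>0$ and $\sigma>0$. For a convex body $K\subset\mathbb R^d$, suppose that one observes $Y_i=h_K(u_i)+\xi_i$, $i=1,\dots,n$, where the errors $\xi_1,\dots,\xi_n$ are independent normal random variables with mean zero and variance $\sigma^2$. Let $$r_n(p,\Gamma):=\inf_{\hat h}\ \sup_{K\in\mathcal K^d(\Gamma)}\ \mathbb E_K\|h_K-\hat h(Y_1,\dots,Y_n)\|_p .$$ Then there is a constant $c>0$ that is independent of $n$ such that for all $n\ge 1$ $$r_n(p,\Gamma)\ \ge\ c\,\sigma^{4/(d+3)}\,\Gamma^{(d-1)/(d+3)}\,n^{-2/(d+3)}.$$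
   Context: A convex body in $\mathbb R^d$ is a compact convex set with nonempty interior. $\mathcal K^d(\Gamma)$ is the set of all convex bodies in $\mathbb R^d$ contained in the closed ball of radius $\Gamma$ centered at the origin. $S^{d-1}$ is the unit sphere of $\mathbb R^d$, and the support function of $K$ is $h_K:S^{d-1}\to\mathbb R$, $h_K(u):=\sup\{\langle x,u\rangle:x\in K\}$. For $p\in[1,\infty)$, $\|g\|_p:=\left(\int_{S^{d-1}}|g(u)|^p\,du\right)^{1/p}$, where $du$ denotes surface measure on $S^{d-1}$. The infimum defining $r_n(p,\Gamma)$ is over all estimators $\hat h$, i.e. (measurable) maps from the data $(Y_1,\dots,Y_n)$ to bounded functions on $S^{d-1}$; $\mathbb E_K$ denotes expectation when the data are generated from $K$. *)

(* Defs.v *)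
From HB Require Import structures.
From mathcomp Require Import all_boot all_order all_algebra.
From mathcomp Require Import all_classical all_reals all_analysis.
From mathcomp Require Import measurable_realfun.
Set Implicit Arguments.
Unset Strict Implicit.
Unset Printing Implicit Defensive.
Import Order.TTheory GRing.Theory Num.Theory.
Import numFieldNormedType.Exports.
Local Open Scope classical_set_scope.
Local Open Scope ring_scope.

(* 'rV[R]_n carries the sigma-algebra generated by its n coordinates, i.e. its
   Borel sigma-algebra. *)
Section rV_measurable.
Context {R : realType} (n : nat).

Let coord : 'I_n -> 'rV[R]_n -> R := fun i x => x ord0 i.

Let rV_set0 : g_sigma_preimage coord set0.
Proof. exact: sigma_algebra0. Qed.

Let rV_setC A : g_sigma_preimage coord A -> g_sigma_preimage coord (~` A).
Proof. exact: sigma_algebraC. Qed.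

Let rV_bigcup (F : (set 'rV[R]_n)^nat) :
  (forall i, g_sigma_preimage coord (F i)) ->
  g_sigma_preimage coord (\bigcup_i (F i)).
Proof. exact: sigma_algebra_bigcup. Qed.

HB.instance Definition _ :=
  @isMeasurable.Build (measure_tuple_display default_measure_display)
    'rV[R]_n (g_sigma_preimage coord) rV_set0 rV_setC rV_bigcup.

End rV_measurable.

Lemma measurable_rV_coord {R : realType} n (i : 'I_n) :
  measurable_fun [set: 'rV[R]_n] (fun x => x ord0 i).
Proof.
move=> _ Y mY; rewrite setTI; apply: sub_sigma_algebra => /=.
rewrite -bigcup_seq/=; exists i => /=; first by rewrite mem_index_enum.
by exists Y => //; rewrite setTI.
Qed.

Lemma measurable_fun_rVP {R : realType} d (T : measurableType d) n
    (f : T -> 'rV[R]_n) :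
  measurable_fun [set: T] f <->
  forall i, measurable_fun [set: T] (fun t => f t ord0 i).
Proof.
split=> [mf i|mf].
  exact: (measurableT_comp (measurable_rV_coord i) mf).
apply: (@measurability _ _ _ _ _ _
  (\big[setU/set0]_(i < n) preimage_set_system setT
     (fun x : 'rV[R]_n => x ord0 i) measurable)) => //.
move=> _ [B + <-]; rewrite -bigcup_seq => -[i _ [A mA <-]].
by rewrite !setTI -[X in measurable X]setTI; exact: mf.
Qed.

Section product_power.
Context {R : realType}.

Definition rV_cons n (z : measurableTypeR R * 'rV[R]_n) : 'rV[R]_n.+1 :=
  row_mx (z.1 : R)%:M z.2 : 'rV[R]_(1 + n).

(* The n-fold product measure mu x ... x mu on R^n. *)
Fixpoint rV_power (mu : set (measurableTypeR R) -> \bar R) (n : nat) :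
    set 'rV[R]_n -> \bar R :=
  match n with
  | 0 => \d_(0 : 'rV[R]_0)
  | n'.+1 => pushforward (mu \x @rV_power mu n')%E (@rV_cons n')
  end.

Let rV_uncons n (v : 'rV[R]_n.+1) : measurableTypeR R * 'rV[R]_n :=
  (v ord0 ord0, \row_j v ord0 (lift ord0 j)).

Let rV_cons0 n (z : measurableTypeR R * 'rV[R]_n) :
  rV_cons z ord0 ord0 = z.1.
Proof.
have -> : (ord0 : 'I_(1 + n)) = lshift n (ord0 : 'I_1) by exact: val_inj.
by apply: etrans (row_mxEl _ _ _ _) _; rewrite mxE eqxx mulr1n.
Qed.

Let rV_consS n (z : measurableTypeR R * 'rV[R]_n) j :
  rV_cons z ord0 (lift ord0 j) = z.2 ord0 j.
Proof.
have -> : (lift ord0 j : 'I_(1 + n)) = rshift 1 j by exact: val_inj.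
by apply: etrans (row_mxEr _ _ _ _) _.
Qed.

Let rV_consK n : cancel (@rV_cons n) (@rV_uncons n).
Proof.
move=> [x v]; rewrite /rV_uncons rV_cons0; congr pair.
by apply/rowP => j; rewrite mxE rV_consS.
Qed.

Let measurable_rV_uncons n : measurable_fun setT (@rV_uncons n).
Proof.
apply/measurable_fun_pairP; split; first exact: measurable_rV_coord.
apply/measurable_fun_rVP => j.
rewrite (_ : (fun t => _) = (fun x : 'rV[R]_n.+1 => x ord0 (lift ord0 j))).
  exact: measurable_rV_coord.
by apply/funext => v; rewrite /= mxE.
Qed.

Lemma measurable_rV_cons n : measurable_fun setT (@rV_cons n).
Proof.
apply/measurable_fun_rVP => i; case: (unliftP ord0 i) => [j|] ->.
- rewrite (_ : (fun t => _) = (fun x : 'rV[R]_n => x ord0 j) \o snd).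
    by apply: measurableT_comp => //; exact: measurable_rV_coord.
  by apply/funext => t; rewrite rV_consS.
- rewrite (_ : (fun t => _) = fst); first exact: measurable_fst.
  by apply/funext => t; rewrite rV_cons0.
Qed.

Variable mu : {sigma_finite_measure set (measurableTypeR R) -> \bar R}.

Let rV_power_sfm n :
  exists m : {sigma_finite_measure set 'rV[R]_n -> \bar R},
    (m : set _ -> _) = @rV_power mu n.
Proof.
elim: n => [|n [m mE]]; first by exists (\d_(0 : 'rV[R]_0)).
pose nu : {measure set 'rV[R]_n.+1 -> \bar R} :=
  measure_function_pushforward__canonical__measure_function_Measure
    (mu \x m)%E (@measurable_rV_cons n).
have nu_sf : sigma_finite setT nu.
  have /sigma_finiteP[F [FT ndF Foo]] := sigma_finiteT mu.
  have /sigma_finiteP[G [GT ndG Goo]] := sigma_finiteT m.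
  exists (fun k => @rV_uncons n @^-1` (F k `*` G k)).
    rewrite -preimage_bigcup [X in _ @^-1` X](_ : _ = setT) ?preimage_setT//.
    apply/seteqP; split=> [//|[x y] _].
    have [k _ Fkx] : (\bigcup_k F k) x by rewrite -FT.
    have [l _ Gly] : (\bigcup_k G k) y by rewrite -GT.
    exists (maxn k l) => //; split => /=.
    - by move: Fkx; exact/subsetPset/ndF/leq_maxl.
    - by move: Gly; exact/subsetPset/ndG/leq_maxr.
  move=> k; have [mF Fk] := Foo k; have [mG Gk] := Goo k; split.
    rewrite -[X in measurable X]setTI; apply: measurable_rV_uncons => //.
    exact: measurableX.
  rewrite /nu /= /pushforward -comp_preimage (_ : _ \o _ = id)//; last first.
    by apply/funext => z /=; rewrite rV_consK.
  by rewrite preimage_id product_measure1E// lte_mul_pinfty// ge0_fin_numE.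
pose nu_mixin := Measure_isSigmaFinite.Build _ _ _ nu nu_sf.
pose nu' : {sigma_finite_measure set 'rV[R]_n.+1 -> \bar R} :=
  HB.pack (Measure.sort nu) nu_mixin.
by exists nu'; rewrite /= /nu /= mE.
Qed.

Let rV_power0 n : @rV_power mu n set0 = 0%E.
Proof. by have [m <-] := rV_power_sfm n; rewrite measure0. Qed.

Let rV_power_ge0 n A : (0 <= @rV_power mu n A)%E.
Proof. by have [m <-] := rV_power_sfm n; exact: measure_ge0. Qed.

Let rV_power_sigma_additive n : semi_sigma_additive (@rV_power mu n).
Proof.
by have [m <-] := rV_power_sfm n; exact: measure_semi_sigma_additive.
Qed.

HB.instance Definition _ n := isMeasure.Build _ _ _ (@rV_power mu n)
  (rV_power0 n) (@rV_power_ge0 n) (@rV_power_sigma_additive n).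

Let rV_power_sigma_finite n : sigma_finite setT (@rV_power mu n).
Proof. by have [m <-] := rV_power_sfm n; exact: sigma_finiteT. Qed.

HB.instance Definition _ n := Measure_isSigmaFinite.Build _ _ _
  (@rV_power mu n) (rV_power_sigma_finite n).

End product_power.
Arguments rV_power {R} mu n.

Section euclidean.
Context {R : realType} (d : nat).
Implicit Types (x u : 'rV[R]_d) (K : set 'rV[R]_d).

Definition dotr x u : R := \sum_(i < d) x ord0 i * u ord0 i.

(* The norm `|x| of the library on 'rV[R]_d is the sup norm. *)
Definition enorm x : R := Num.sqrt (dotr x x).

Definition sphere : set 'rV[R]_d := [set u | enorm u = 1].

Definition eball (r : R) : set 'rV[R]_d := [set x | enorm x <= r].

Definition convex_body K :=
  [/\ compact K, convex_set (K : set (convex_lmodType 'rV[R]_d)) &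
      interior K !=set0].

Definition bodies_in_ball (Gamma : R) : set (set 'rV[R]_d) :=
  [set K | convex_body K /\ K `<=` eball Gamma].

Definition support_fun K u : R := sup [set dotr x u | x in K].

Lemma dotr_ge0 x : 0 <= dotr x x.
Proof. by apply: sumr_ge0 => i _; rewrite -expr2 sqr_ge0. Qed.

Lemma measurable_enorm : measurable_fun setT enorm.
Proof.
rewrite (_ : enorm = (fun x => dotr x x `^ 2^-1)); last first.
  by apply/funext => x; rewrite powR12_sqrt// dotr_ge0.
apply: (measurableT_comp (measurable_powR 2^-1)).
apply: measurable_sum => i.
by apply: measurable_funM; exact: measurable_rV_coord.
Qed.

Definition direction x : 'rV[R]_d := (enorm x)^-1 *: x.

Lemma measurable_direction : measurable_fun setT direction.
Proof.
apply/measurable_fun_rVP => i.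
rewrite (_ : (fun x => _) = (fun x => enorm x `^ (-1) * x ord0 i)); last first.
  by apply/funext => x; rewrite mxE powR_inv1// sqrtr_ge0.
apply: measurable_funM; last exact: measurable_rV_coord.
exact: (measurableT_comp (measurable_powR (-1)) measurable_enorm).
Qed.

Lemma measurable_eball r : measurable (eball r).
Proof.
rewrite (_ : eball r = enorm @^-1` `]-oo, r]); last first.
  by apply/seteqP; split => x /=; rewrite in_itv.
by rewrite -[X in measurable X]setTI; exact: measurable_enorm.
Qed.

Lemma measurable_sphere : measurable sphere.
Proof.
rewrite (_ : sphere = enorm @^-1` [set 1])//.
by rewrite -[X in measurable X]setTI; exact: measurable_enorm.
Qed.

Definition lebesgue_rV : set 'rV[R]_d -> \bar R := rV_power lebesgue_measure d.

HB.instance Definition _ := SigmaFiniteMeasure.on lebesgue_rV.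

(* Surface measure on the unit sphere, from polar coordinates: a Borel subset A
   of the sphere has measure d times the volume of {t *: u | 0 < t <= 1, A u}.
   The origin plays no role, as direction 0 = 0 is not on the sphere. *)
Definition surface_measure (A : set 'rV[R]_d) : \bar R :=
  (d%:R%:E * lebesgue_rV [set x | A (direction x) /\ eball 1 x])%E.

Let surface_measureE :
  exists m : {measure set 'rV[R]_d -> \bar R},
    (m : set _ -> _) = surface_measure.
Proof.
pose m1 : {measure set 'rV[R]_d -> \bar R} :=
  measure_function_mrestr__canonical__measure_function_Measure
    lebesgue_rV (measurable_eball 1).
pose m2 : {measure set 'rV[R]_d -> \bar R} :=
  measure_function_pushforward__canonical__measure_function_Measure
    m1 measurable_direction.
by exists (mscale (NngNum (ler0n R d)) m2).
Qed.

Let surface_measure0 : surface_measure set0 = 0%E.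
Proof. by have [m <-] := surface_measureE; rewrite measure0. Qed.

Let surface_measure_ge0 A : (0 <= surface_measure A)%E.
Proof. by have [m <-] := surface_measureE; exact: measure_ge0. Qed.

Let surface_measure_sigma_additive : semi_sigma_additive surface_measure.
Proof.
by have [m <-] := surface_measureE; exact: measure_semi_sigma_additive.
Qed.

HB.instance Definition _ := isMeasure.Build _ _ _ surface_measure
  surface_measure0 surface_measure_ge0 surface_measure_sigma_additive.

(* Functions on the sphere are represented by functions on 'rV[R]_d of which
   only the values on the sphere matter. *)
Definition sphere_Lnorm (p : R) (g : 'rV[R]_d -> R) : \bar R :=
  ((\int[surface_measure]_(u in sphere) (`|g u| `^ p)%:E) `^ p^-1)%E.

Definition bounded_measurable_on_sphere (g : 'rV[R]_d -> R) :=
  measurable_fun sphere g /\ exists M, forall u, sphere u -> `|g u| <= M.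

End euclidean.

Arguments sphere {R} d.
Arguments eball {R} d r.
Arguments bodies_in_ball {R} d Gamma.
Arguments lebesgue_rV {R} d.
Arguments surface_measure {R} d.

Section minimax.
Context {R : realType} (d : nat).
Implicit Types (u : nat -> 'rV[R]_d) (K : set 'rV[R]_d).

(* Measurable maps from the data to the bounded (Borel) functions on the sphere,
   the latter with the sigma-algebra for which the distance in p-norm to each
   function is measurable.  Every bounded-valued hhat that is jointly measurable
   in the data and the direction is of this form. *)
Definition estimator (p : R) n (hhat : 'rV[R]_n -> 'rV[R]_d -> R) :=
  (forall y, bounded_measurable_on_sphere (hhat y)) /\
  (forall g, bounded_measurable_on_sphere g ->
    measurable_fun [set: 'rV[R]_n] (fun y => sphere_Lnorm p (g \- hhat y))).

(* The directions u_1, u_2, ... are numbered u 0, u 1, ... *)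
Definition observation u n K (xi : 'rV[R]_n) : 'rV[R]_n :=
  \row_(i < n) (support_fun K (u i) + xi ord0 i).

(* E_K || h_K - hhat(Y_1, ..., Y_n) ||_p: the noise vector has the law of n
   independent N(0, sigma^2) variables; the second parameter of normal_prob is
   the standard deviation. *)
Definition risk u (p sigma : R) n (hhat : 'rV[R]_n -> 'rV[R]_d -> R) K
    : \bar R :=
  (\int[rV_power (normal_prob 0 sigma) n]_xi
     sphere_Lnorm p (support_fun K \- hhat (observation u K xi))%R)%E.

Definition minimax_risk u (sigma : R) n (p Gamma : R) : \bar R :=
  ereal_inf [set ereal_sup [set risk u p sigma hhat K |
                            K in bodies_in_ball d Gamma] |
             hhat in @estimator p n].

End minimax.

(* Main.v *)
Require Import Defs.
From HB Require Import structures.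
From mathcomp Require Import all_boot all_order all_algebra.
From mathcomp Require Import all_classical all_reals all_analysis.
From mathcomp Require Import measurable_realfun.
From mathcomp Require Import ring lra.
Set Implicit Arguments.
Unset Strict Implicit.
Unset Printing Implicit Defensive.
Import Order.TTheory GRing.Theory Num.Theory.
Import numFieldNormedType.Exports.
Local Open Scope classical_set_scope.
Local Open Scope ring_scope.

(* Assouad's lemma over the bodies obtained from the ball of radius Gamma / 2 by
   adding spikes (1 + eps) v_j Gamma / 2 in directions v_j that come from a grid
   with m^(d-1) points in a chart of the sphere.  The caps on which the spikes
   are visible in the support function are disjoint, so a choice of spikes
   changes the support function by at most eps on the caps concerned.  With
   eps of order m^-2, n observations u_i carry bounded information per spike,
   on average over the spikes, as soon as n eps^2 <~ m^(d-1), i.e.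
   m ~ n^(1/(d+3)); the loss is then of order eps ~ n^(-2/(d+3)).  An estimator
   enters only through the nearest hypothesis, which keeps the argument within
   the measurability that [estimator] provides. *)

(** * Gaussian shifts *)

(** Curvature forces eps ~ m^-2: a spike of relative height eps is visible on a cap of angular
    radius about sqrt(2 eps), while neighbouring grid directions are about 1/m apart. The u_i are
    arbitrary and may crowd into a few caps, whose spikes are then easy to detect. So each spike j
    keeps its own information bound D_j, and what has to be large is the sum of the exp(-D_j); since
    each u_i lies in at most one cap, the D_j cannot all be large. Testing rests on one inequality
    for Gaussian shifts, P_a(A)^2 <= exp(|a - b|^2 / sigma^2) P_b(A), which is Cauchy-Schwarz with
    the chi-square integral of the two densities; its factor is multiplicative over coordinates, so
    the n-fold product follows by induction. In the loss, p-th powers add up over disjoint caps,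
    whereas Assouad's argument wants a loss linear in the Hamming distance. The fraction of
    differing spikes is at most 1 and p >= 1, so the fraction is at most its own p-th root, which
    gives the linear bound. *)

Lemma measurable_fun_EFin d (T : measurableType d) (R : realType) (D : set T)
    (g : T -> R) :
  measurable_fun D g -> measurable_fun D (fun x => (g x)%:E).
Proof. by move=> ?; exact/measurable_EFinP. Qed.

Section normal_shift.
Context {R : realType}.
Local Notation mu := (@lebesgue_measure R).

(** Lebesgue measure is determined by its values on half-open intervals, and a shift preserves their
    lengths. *)
Lemma lebesgue_measure_shift (a : R) (A : set R) : measurable A ->
  pushforward mu ((fun x => a + x) : _ -> measurableTypeR R) A = mu A.
Proof.
have ma : measurable_fun setT ((fun x => a + x) : R -> measurableTypeR R).
  exact: measurable_funD.
pose nu : {measure set (measurableTypeR R) -> \bar R} :=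
  measure_function_pushforward__canonical__measure_function_Measure mu ma.
move=> mA; apply/esym/(@lebesgue_measure_unique _ nu) => //= _ [[x y]] _ <-.
rewrite /nu/= /pushforward (_ : _ @^-1` _ = `]x - a, y - a]%classic); last first.
  by apply/seteqP; split => t /=; rewrite !in_itv/= ltrBlDl lerBrDl.
rewrite !lebesgue_measure_itv/= !lte_fin ltrD2r.
by case: ifP => // _; rewrite -!EFinD; congr EFin; ring.
Qed.

Lemma ge0_integral_shift (a : R) (f : R -> \bar R) :
  measurable_fun [set: R] f -> (forall x, 0 <= f x)%E ->
  (\int[mu]_x f (a + x)%R = \int[mu]_x f x)%E.
Proof.
move=> mf f0.
transitivity (\int[pushforward mu
    ((fun x => (a + x)%R) : R -> measurableTypeR R)]_x f x)%E.
  by rewrite ge0_integral_pushforward//=; exact: measurable_funD.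
apply: eq_measure_integral => [|ma A mA _]; first exact: measurable_funD.
exact: lebesgue_measure_shift.
Qed.

(** The Radon-Nikodym derivative and [normal_pdf] have the same integral over every measurable set,
    hence agree almost everywhere. *)
Lemma ge0_integral_normal_prob (m s : R) (f : R -> \bar R) :
  measurable_fun [set: R] f -> (forall x, 0 <= f x)%E ->
  (\int[normal_prob m s]_x f x = \int[mu]_x (f x * (normal_pdf m s x)%:E))%E.
Proof.
move=> mf f0.
have dom := normal_prob_dominates m s.
have /= <- := Radon_Nikodym_SigmaFinite.change_of_variables dom f0 measurableT mf.
apply: ae_eq_integral => //.
- apply: emeasurable_funM => //.
  exact: measurable_int (Radon_Nikodym_SigmaFinite.f_integrable dom).
- apply: emeasurable_funM => //.
  by apply/measurable_EFinP; exact: measurable_normal_pdf.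
apply: ae_eqe_mul2l; apply: integral_ae_eq => //.
- exact: Radon_Nikodym_SigmaFinite.f_integrable.
- by apply/measurable_EFinP; exact: measurable_normal_pdf.
by move=> A _ mA; rewrite -(Radon_Nikodym_SigmaFinite.f_integral dom).
Qed.

Lemma normal_pdf_shift (m s a x : R) : s != 0 ->
  normal_pdf (m + a) s (a + x) = normal_pdf m s x.
Proof.
move=> s0; rewrite !normal_pdfE//; congr (_ * expR _).
by congr (- _ ^+ 2 / _); ring.
Qed.

Lemma ge0_integral_normal_prob_shift (m s a : R) (f : R -> \bar R) :
  s != 0 ->
  measurable_fun [set: R] f -> (forall x, 0 <= f x)%E ->
  (\int[normal_prob m s]_x f (a + x)%R = \int[normal_prob (m + a) s]_x f x)%E.
Proof.
move=> s0 mf f0.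
have mfa : measurable_fun [set: R] (fun x => f (a + x)).
  by apply: (measurableT_comp mf); exact: measurable_funD.
rewrite (ge0_integral_normal_prob _ _ mf f0).
rewrite (ge0_integral_normal_prob _ _ mfa (fun x => f0 (a + x))).
rewrite -[RHS](ge0_integral_shift a); last 2 first.
- apply: emeasurable_funM => //.
  by apply/measurable_EFinP; exact: measurable_normal_pdf.
- by move=> x; rewrite mule_ge0// lee_fin normal_pdf_ge0.
by apply: eq_integral => x _; rewrite normal_pdf_shift.
Qed.

(** Completing the square: p_a^2 / p_b is, up to a constant factor, the normal density centred at
    the reflection [2 * a - b] of [b] in [a]. Integrating gives the chi-square integral exp((a -
    b)^2 / s^2). *)
Lemma normal_pdf_ratio (a b s x : R) : s != 0 ->
  normal_pdf a s x ^+ 2 =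
  expR ((a - b) ^+ 2 / s ^+ 2) * normal_pdf (2 * a - b) s x * normal_pdf b s x.
Proof.
move=> s0; rewrite !normal_pdfE// /normal_fun.
rewrite exprMn -expRM_natl mulrACA expr2 -!mulrA [RHS]mulrCA; congr (_ * _).
rewrite mulrCA; congr (_ * _); rewrite -!expRD; congr expR; field.
by rewrite s0.
Qed.

End normal_shift.

Section unit_interval_expectation.
Context d (T : measurableType d) (R : realType) (P : probability T R).
Implicit Type f : T -> R.

Lemma ge0_integral01_EFin f :
  measurable_fun [set: T] f -> (forall x, 0 <= f x <= 1) ->
  (\int[P]_x (f x)%:E = (\int[P]_x f x)%R%:E)%E.
Proof.
move=> mf f01; rewrite /Rintegral fineK//.
apply: integrable_fin_num => //.
apply: measurable_bounded_integrable => //=.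
  by rewrite [ltLHS](_ : _ = 1%E) ?ltry// probability_setT.
exists 1; split => // M M1 x _ /=; have /andP[f0 f1] := f01 x.
by rewrite ger0_norm// (le_trans f1)// ltW.
Qed.

Lemma Rintegral01 f :
  measurable_fun [set: T] f -> (forall x, 0 <= f x <= 1) ->
  0 <= \int[P]_x f x <= 1.
Proof.
move=> mf f01; rewrite -!lee_fin -ge0_integral01_EFin//; apply/andP; split.
  by apply: integral_ge0 => x _; rewrite lee_fin; case/andP: (f01 x).
rewrite -(probability_setT P) -[leRHS]mul1e -integral_cst//.
apply: ge0_le_integral => //.
- by move=> x _; rewrite lee_fin; case/andP: (f01 x).
- exact/measurable_EFinP.
- by move=> x _; rewrite lee_fin; case/andP: (f01 x).
Qed.

End unit_interval_expectation.

(** * Product probabilities and Tonelli over the first coordinate *)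

Section power.
Context {R : realType}.
Variable mu : probability (measurableTypeR R) R.

Lemma rV_power_setT n : rV_power mu n [set: 'rV[R]_n] = 1%E.
Proof.
elim: n => [|n IH]; first by rewrite /= diracT.
rewrite /= /pushforward preimage_setT -setXTT product_measure1E//= IH.
by rewrite probability_setT mule1.
Qed.

HB.instance Definition _ n :=
  @Measure_isProbability.Build _ _ R (rV_power mu n) (rV_power_setT n).

Lemma ge0_integral_rV_powerS n (f : 'rV[R]_n.+1 -> \bar R) :
  measurable_fun setT f -> (forall x, 0 <= f x)%E ->
  (\int[rV_power mu n.+1]_x f x =
   \int[mu]_x \int[rV_power mu n]_y f (rV_cons (x, y)))%E.
Proof.
move=> mf f0.
rewrite -[RHS](@fubini_tonelli1 _ _ _ _ _ mu (rV_power mu n)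
  (fun z => f (rV_cons z))); last 2 first.
- by apply: (measurableT_comp mf); exact: measurable_rV_cons.
- by [].
have mc := @measurable_rV_cons R n.
rewrite -[RHS](ge0_integral_pushforward mc (mu \x rV_power mu n)%E
  measurableT mf)//.
Qed.

End power.

(** * Cauchy-Schwarz between two Gaussian shifts *)

Section gaussian_cauchy_schwarz.
Context {R : realType}.
Local Notation mu := (@lebesgue_measure R).

(** Optimising over [t] recovers Cauchy-Schwarz from a family of inequalities linear in the
    integrals, each of which can be checked pointwise under the integral sign. *)
Lemma sqr_le_of_AMGM (X Y E : R) : 0 <= X -> 0 < E ->
  (forall t, 0 < t -> 2 * X <= t * Y + E / t) -> X ^+ 2 <= E * Y.
Proof.
move=> X0 E0 H; have [->|Xn0] := eqVneq X 0.
  have Y0 : 0 <= Y.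
    rewrite leNgt; apply/negP => Y0.
    (* For a negative [Y], this [t], increased by 1, makes the right-hand side negative. *)
    have t0 : 0 < (1 + E) / - Y by apply: divr_gt0; [lra|rewrite oppr_gt0].
    have := H _ (addr_gt0 t0 ltr01).
    set t := _ + 1; have t1 : 1 < t by rewrite ltrDr.
    have : t * Y = - (1 + E) + Y.
      by rewrite /t mulrDl mul1r invrN mulrN mulNr divfK// lt_eqF.
    have : E / t <= E by rewrite ler_pdivrMr ?(lt_trans ltr01)// ler_peMr// ltW.
    lra.
  by rewrite expr0n/= mulr_ge0// ltW.
have Xp : 0 < X by rewrite lt_def Xn0.
(* At [t = E / X] the second term [E / t] is just [X]. *)
have := H (E / X) (divr_gt0 E0 Xp).
rewrite invf_div mulrCA divff ?gt_eqF// mulr1 => h.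
have : X <= E / X * Y by lra.
by rewrite mulrAC ler_pdivlMr// expr2.
Qed.

(** Write f p_a as (f sqrt p_b) (p_a / sqrt p_b) and apply Cauchy-Schwarz. The bound is stated for
    functions into [0, 1], not only for indicators, because the induction over coordinates applies
    it to inner expectations. *)
Lemma normal_cauchy_schwarz (s a b : R) (f : R -> R) : s != 0 ->
  measurable_fun [set: R] f -> (forall x, 0 <= f x <= 1) ->
  (\int[normal_prob 0 s]_x f (a + x)) ^+ 2 <=
  expR ((a - b) ^+ 2 / s ^+ 2) * \int[normal_prob 0 s]_x (f (b + x) ^+ 2).
Proof.
move=> s0 mf f01.
have msh (c : R) (g : R -> R) : measurable_fun [set: R] g ->
    measurable_fun [set: R] (fun x => g (c + x)).
  by move=> mg; apply: (measurableT_comp mg); exact: measurable_funD.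
have mf2 : measurable_fun [set: R] (fun x => f x ^+ 2) by exact: measurable_funX.
have f0 x : 0 <= f x by case/andP: (f01 x).
have f201 x : 0 <= f x ^+ 2 <= 1.
  by rewrite sqr_ge0/= exprn_ile1//; case/andP: (f01 x).
have Ef c (g : R -> R) : measurable_fun [set: R] g -> (forall x, 0 <= g x <= 1) ->
    ((\int[normal_prob 0 s]_x g (c + x))%:E =
     \int[mu]_x (g x * normal_pdf c s x)%:E)%E.
  move=> mg g01.
  rewrite -ge0_integral01_EFin//; last exact: msh.
  rewrite (ge0_integral_normal_prob_shift 0 c s0 (f := EFin \o g)); last 2 first.
  - exact/measurable_EFinP.
  - by move=> x; rewrite lee_fin; case/andP: (g01 x).
  rewrite add0r ge0_integral_normal_prob//.
  - exact/measurable_EFinP.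
  - by move=> x; rewrite lee_fin; case/andP: (g01 x).
set E := expR _.
have Efa01 := Rintegral01 (normal_prob 0 s) (msh a _ mf) (fun x => f01 (a + x)).
apply: sqr_le_of_AMGM; [by case/andP: Efa01|exact: expR_gt0|].
move=> t t0.
rewrite -lee_fin EFinD (EFinM 2) (EFinM t) Ef// (Ef _ (fun x => f x ^+ 2))//.
have mp c : measurable_fun [set: R] (normal_pdf c s) by exact: measurable_normal_pdf.
have mE (g : R -> R) : measurable_fun [set: R] g ->
    measurable_fun [set: R] (fun x => (g x)%:E) by exact: measurable_fun_EFin.
have p0 c x : 0 <= normal_pdf c s x by exact: normal_pdf_ge0.
(* The constant becomes an integral against a normal density of total mass 1, so that both sides can
   be compared pointwise. *)
have <- : (\int[mu]_x (E / t * normal_pdf (2 * a - b) s x)%:E = (E / t)%:E)%E.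
  under eq_integral do rewrite EFinM.
  rewrite ge0_integralZl_EFin//=.
  - by rewrite integral_normal_pdf mule1.
  - by move=> x _; rewrite lee_fin.
  - exact: (mE _ (mp _)).
  - by rewrite divr_ge0 ?expR_ge0// ltW.
rewrite -!ge0_integralZl_EFin//=; last 5 first.
- by move=> x _; rewrite lee_fin mulr_ge0// sqr_ge0.
- by apply: mE; exact: measurable_funM.
- by rewrite ltW.
- by move=> x _; rewrite lee_fin mulr_ge0.
- by apply: mE; exact: measurable_funM.
rewrite -ge0_integralD//=; first last.
- by apply: mE; exact: measurable_funM.
- by move=> x _; rewrite lee_fin !mulr_ge0// ?expR_ge0// invr_ge0 ltW.
- by apply: mE; apply/measurable_funM => //; exact: measurable_funM.
- by move=> x _; rewrite -EFinM lee_fin !mulr_ge0// ?sqr_ge0// ltW.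
apply: ge0_le_integral => //=.
- by move=> x _; rewrite -EFinM lee_fin !mulr_ge0.
- by apply: mE; apply/measurable_funM => //; exact: measurable_funM.
- apply: mE; apply: measurable_funD;
    by apply: measurable_funM => //; exact: measurable_funM.
move=> x _; rewrite -!EFinM -EFinD lee_fin.
have H := normal_pdf_ratio a b x s0; rewrite -/E in H.
have := f0 x; move: (p0 a x) (p0 b x) (p0 (2 * a - b) x) H.
move: (normal_pdf a s x) (normal_pdf b s x) (normal_pdf (2 * a - b) s x) (f x).
move=> pa pb pc y pa0 pb0 pc0 H y0.
have E0 : 0 < E := expR_gt0 _.
have [pb00|pbn0] := eqVneq pb 0.
  move: H; rewrite pb00 mulr0 => /eqP; rewrite sqrf_eq0 => /eqP ->.
  by rewrite !mulr0 add0r mulr_ge0// divr_ge0 ?ltW.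
have pbp : 0 < pb by rewrite lt_def pbn0.
rewrite -subr_ge0.
(* By [normal_pdf_ratio], pa^2 = E pc pb, which makes the difference a perfect square over
   [t * pb]. *)
suff -> : t * (y ^+ 2 * pb) + E / t * pc - 2 * (y * pa) =
    (t * y * pb - pa) ^+ 2 / (t * pb).
  by rewrite divr_ge0 ?sqr_ge0// mulr_ge0// ltW.
rewrite sqrrB H; field.
by rewrite pbn0 gt_eqF.
Qed.

End gaussian_cauchy_schwarz.

Section gaussian_vectors.
Context {R : realType}.

Lemma measurable_rV_shift n (a : 'rV[R]_n) :
  measurable_fun setT (fun x : 'rV[R]_n => a + x).
Proof.
apply/measurable_fun_rVP => i.
rewrite (_ : (fun t => _) = (fun x : 'rV[R]_n => a ord0 i + x ord0 i)); last first.
  by apply/funext => x; rewrite mxE.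
by apply: measurable_funD => //; exact: measurable_rV_coord.
Qed.

Lemma rV_cons_ord0 n (z : measurableTypeR R * 'rV[R]_n) :
  rV_cons z ord0 ord0 = z.1.
Proof.
have -> : (ord0 : 'I_(1 + n)) = lshift n (ord0 : 'I_1) by exact: val_inj.
by apply: etrans (row_mxEl _ _ _ _) _; rewrite mxE eqxx mulr1n.
Qed.

Lemma rV_cons_lift n (z : measurableTypeR R * 'rV[R]_n) j :
  rV_cons z ord0 (lift ord0 j) = z.2 ord0 j.
Proof.
have -> : (lift ord0 j : 'I_(1 + n)) = rshift 1 j by exact: val_inj.
by apply: etrans (row_mxEr _ _ _ _) _.
Qed.

Lemma rV_consD n (a : 'rV[R]_n.+1) (x : R) (y : 'rV[R]_n) :
  a + rV_cons (x, y) =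
  rV_cons (a ord0 ord0 + x, \row_j a ord0 (lift ord0 j) + y).
Proof.
apply/rowP => i; rewrite mxE; case: (unliftP ord0 i) => [j|] ->.
  by rewrite !rV_cons_lift !mxE.
by rewrite !rV_cons_ord0.
Qed.

Variable s : R.
Hypothesis s0 : s != 0.
Local Notation P := (rV_power (normal_prob 0 s)).

(** Tensorisation: the exponents of the coordinates add up, because the one-dimensional bound has
    f^2 on the right, which is what the induction hypothesis produces for the inner integral. *)
Lemma rV_power_cauchy_schwarz n (a b : 'rV[R]_n) (f : 'rV[R]_n -> R) :
  measurable_fun [set: 'rV[R]_n] f -> (forall x, 0 <= f x <= 1) ->
  (\int[P n]_x f (a + x)) ^+ 2 <=
  expR ((\sum_i (a ord0 i - b ord0 i) ^+ 2) / s ^+ 2) *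
  \int[P n]_x (f (b + x) ^+ 2).
Proof.
elim: n a b f => [|n IH] a b f mf f01.
  rewrite big_ord0 mul0r expR0 mul1r (thinmx0 b) (thinmx0 a) /Rintegral.
  have mf0 : measurable_fun setT (fun x : 'rV[R]_0 => f (0 + x)).
    exact: (measurableT_comp mf (measurable_rV_shift 0)).
  rewrite !integral_dirac//=.
  - by rewrite indicE in_setT !mul1r.
  - by apply: measurable_fun_EFin; exact: measurable_funX.
  - exact: measurable_fun_EFin.
set a' := \row_j a ord0 (lift ord0 j); set b' := \row_j b ord0 (lift ord0 j).
(* Expectation over all coordinates but the first, which is held at [t]. *)
pose F (c : 'rV[R]_n) (g : 'rV[R]_n.+1 -> R) (t : R) : R :=
  \int[P n]_y g (rV_cons (t, c + y)).
have mcons (c : 'rV[R]_n) (g : 'rV[R]_n.+1 -> R) : measurable_fun setT g ->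
    measurable_fun setT
      (fun z : measurableTypeR R * 'rV[R]_n => g (rV_cons (z.1, c + z.2))).
  move=> mg; apply: (measurableT_comp mg).
  apply: (measurableT_comp (@measurable_rV_cons R n)).
  apply/measurable_fun_pairP; split; first exact: measurable_fst.
  exact: (measurableT_comp (measurable_rV_shift c) measurable_snd).
have msec (c : 'rV[R]_n) (g : 'rV[R]_n.+1 -> R) t : measurable_fun setT g ->
    measurable_fun setT (fun y : 'rV[R]_n => g (rV_cons (t, c + y))).
  move=> mg; exact: (measurableT_comp (mcons c g mg) (measurable_pair1 t)).
have F01 c (g : 'rV[R]_n.+1 -> R) t : measurable_fun setT g ->
    (forall x, 0 <= g x <= 1) -> 0 <= F c g t <= 1.
  by move=> mg g01; apply: Rintegral01 => //; exact: msec.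
have mF c (g : 'rV[R]_n.+1 -> R) : measurable_fun setT g ->
    (forall x, 0 <= g x <= 1) ->
    measurable_fun [set: R] (F c g).
  move=> mg g01; apply/measurable_EFinP.
  rewrite (_ : _ \o _ = fubini_F (P n) (fun z : measurableTypeR R * 'rV[R]_n =>
      (g (rV_cons (z.1, c + z.2)))%:E)); last first.
    apply/funext => t; rewrite /= /F -ge0_integral01_EFin//; exact: msec.
  apply: measurable_fun_fubini_tonelli_F.
    by apply: measurable_fun_EFin; exact: mcons.
  by move=> z /=; rewrite lee_fin; case/andP: (g01 (rV_cons (z.1, c + z.2))).
have intS c (g : 'rV[R]_n.+1 -> R) : measurable_fun setT g ->
    (forall x, 0 <= g x <= 1) ->
    \int[P n.+1]_x g (c + x) =
    \int[normal_prob 0 s]_t F (\row_j c ord0 (lift ord0 j)) g (c ord0 ord0 + t).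
  move=> mg g01; apply: EFin_inj.
  have mgc : measurable_fun setT (fun x : 'rV[R]_n.+1 => g (c + x)).
    by apply: (measurableT_comp mg); exact: measurable_rV_shift.
  rewrite -ge0_integral01_EFin// ge0_integral_rV_powerS; last 2 first.
  - exact/measurable_EFinP.
  - by move=> x; rewrite lee_fin; case/andP: (g01 (c + x)).
  rewrite -ge0_integral01_EFin//; last 2 first.
  - by apply: (measurableT_comp (mF _ _ mg g01)); exact: measurable_funD.
  - by move=> t; exact: F01.
  apply: eq_integral => t _; rewrite /F -ge0_integral01_EFin//; last exact: msec.
  by apply: eq_integral => y _; rewrite rV_consD.
have mf2 : measurable_fun setT (fun x : 'rV[R]_n.+1 => f x ^+ 2).
  exact: measurable_funX.
have f201 x : 0 <= f x ^+ 2 <= 1.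
  by rewrite sqr_ge0/= exprn_ile1//; case/andP: (f01 x).
rewrite intS// (intS b (fun x => f x ^+ 2))// -/a' -/b'.
(* The one-dimensional bound moves the first coordinate from [a] to [b]; the induction hypothesis
   then moves the others, for each fixed [t]. *)
apply: (le_trans (normal_cauchy_schwarz (a ord0 ord0) (b ord0 ord0) s0
  (mF a' f mf f01) (fun t => F01 a' f t mf f01))).
rewrite big_ord_recl mulrDl expRD -mulrA ler_pM2l ?expR_gt0//.
set E := expR _.
have step t : F a' f t ^+ 2 <= E * F b' (fun x => f x ^+ 2) t.
  have := IH a' b' (fun y => f (rV_cons (t, y))) _ _.
  rewrite /E; under eq_bigr do rewrite !mxE; apply => //.
  exact: (measurableT_comp mf
    (measurableT_comp (@measurable_rV_cons R n) (measurable_pair1 t))).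
have bsh (g : R -> R) : measurable_fun [set: R] g ->
    measurable_fun [set: R] (fun x => g (b ord0 ord0 + x)).
  by move=> mg; apply: (measurableT_comp mg); exact: measurable_funD.
have Fsq t : 0 <= F a' f t ^+ 2 <= 1.
  by rewrite sqr_ge0/= exprn_ile1//; case/andP: (F01 a' f t mf f01).
have mFb := mF b' _ mf2 f201.
rewrite -lee_fin EFinM -!ge0_integral01_EFin//; last 3 first.
- exact: bsh.
- by move=> x; exact: F01.
- by apply: (bsh (fun x => F a' f x ^+ 2)); apply: measurable_funX; exact: mF.
rewrite -ge0_integralZl_EFin//; last 3 first.
- move=> x _; rewrite lee_fin.
  by case/andP: (F01 b' _ (b ord0 ord0 + x) mf2 f201).
- by apply: measurable_fun_EFin; exact: bsh.
- exact: expR_ge0.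
apply: ge0_le_integral => //.
- by move=> x _; rewrite lee_fin sqr_ge0.
- apply: measurable_fun_EFin; apply: (bsh (fun x => F a' f x ^+ 2)).
  by apply: measurable_funX; exact: mF.
- by apply: measurable_funeM; apply: measurable_fun_EFin; exact: bsh.
- by move=> x _; rewrite -EFinM lee_fin; exact: step.
Qed.

End gaussian_vectors.

(** * Testing between two Gaussian shifts *)

Section two_points.
Context {R : realType} (s : R) (s0 : s != 0) (n : nat).
Local Notation P := (rV_power (normal_prob 0 s) n).

(** An indicator is its own square, so the expectation of the square is again a probability. *)
Lemma rV_power_shift_prob (a b : 'rV[R]_n) (A : set 'rV[R]_n) : measurable A ->
  fine (P ((fun x => a + x) @^-1` A)) ^+ 2 <=
  expR ((\sum_i (a ord0 i - b ord0 i) ^+ 2) / s ^+ 2) *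
  fine (P ((fun x => b + x) @^-1` A)).
Proof.
move=> mA.
have mc (c : 'rV[R]_n) : measurable ((fun x => c + x) @^-1` A).
  by rewrite -[X in measurable X]setTI; exact: measurable_rV_shift.
have EP (c : 'rV[R]_n) :
    fine (P ((fun x => c + x) @^-1` A)) = \int[P]_x (\1_A (c + x)).
  rewrite /Rintegral; congr fine.
  have := integral_indic P measurableT (mc c); rewrite setIT => <-.
  exact: eq_integral.
have i01 (x : 'rV[R]_n) : 0 <= (\1_A x : R) <= 1.
  by rewrite indicE; case: (_ \in _); rewrite ?lexx ?ler01.
rewrite !EP.
have := rV_power_cauchy_schwarz s0 a b (measurable_indic mA) i01.
congr (_ <= _ * _).
apply: eq_Rintegral => x _.
by rewrite indicE; case: (_ \in _); rewrite ?expr1n ?expr0n.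
Qed.

Lemma two_point_test (a b : 'rV[R]_n) (A : set 'rV[R]_n) : measurable A ->
  expR (- ((\sum_i (a ord0 i - b ord0 i) ^+ 2) / s ^+ 2)) / 4 <=
  fine (P ((fun x => a + x) @^-1` A)) + fine (P ((fun x => b + x) @^-1` (~` A))).
Proof.
move=> mA; set D := _ / s ^+ 2.
have D0 : 0 <= D.
  by rewrite divr_ge0 ?sqr_ge0// sumr_ge0// => i _; rewrite sqr_ge0.
have mc (c : 'rV[R]_n) (B : set 'rV[R]_n) : measurable B ->
    measurable ((fun x => c + x) @^-1` B).
  by move=> mB; rewrite -[X in measurable X]setTI; exact: measurable_rV_shift.
have mA' := measurableC mA.
have Hc : fine (P ((fun x => a + x) @^-1` (~` A))) =
    1 - fine (P ((fun x => a + x) @^-1` A)).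
  rewrite preimage_setC probability_setC; last exact: mc.
  by rewrite fineB//; apply: fin_num_measure; exact: mc.
have H := rV_power_shift_prob a b mA'; rewrite -/D Hc in H.
have p0 (c : 'rV[R]_n) (B : set 'rV[R]_n) :
    0 <= fine (P ((fun x => c + x) @^-1` B)) by exact: fine_ge0.
have eD1 : expR (- D) <= 1 by rewrite -expR0 ler_expR oppr_le0.
have eD0 := expR_gt0 (- D).
move: (p0 a A) (p0 b (~` A)) H; set x := fine _; set y := fine _ => x0 y0 H.
have [xl|xl] := leP (1 / 2) x; first by lra.
have : expR (- D) * (1 - x) ^+ 2 <= y.
  apply: (le_trans (ler_wpM2l (expR_ge0 _) H)).
  by rewrite mulrA -expRD addNr expR0 mul1r.
have : 4^-1 <= (1 - x) ^+ 2 by nra.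
move=> h1 h2; apply: (le_trans _ (le_trans h2 _)); last by lra.
by rewrite ler_pM2l.
Qed.

End two_points.

(** * Measurable choice of a minimiser in a finite family *)

Section selector.
Context d (T : measurableType d) (R : realType) (I : finType) (i0 : I).

Lemma measurable_argmin (F : I -> T -> \bar R) :
  (forall i, measurable_fun [set: T] (F i)) ->
  exists2 sel : T -> I, (forall A : set I, measurable (sel @^-1` A)) &
    forall t i, (F (sel t) t <= F i t)%E.
Proof.
move=> mF.
(* Induction on the candidates considered so far; [i0] is the choice from the empty list. *)
suff H (r : seq I) : exists2 sel : T -> I,
    (forall i, measurable (sel @^-1` [set i])) &
    forall t i, i \in r -> (F (sel t) t <= F i t)%E.
  have [sel msel Fsel] := H (enum I).
  exists sel => [A|t i]; last by rewrite Fsel// mem_enum.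
  rewrite (_ : _ @^-1` _ = \bigcup_(i in A) (sel @^-1` [set i])); last first.
    by apply/seteqP; split => [t ?|t [i Ai /= ->//]]; exists (sel t).
  by rewrite bigcup_mkcond; apply: fin_bigcup_measurable => // i _; case: ifP.
elim: r => [|x r [sel msel Fsel]].
  exists (fun=> i0) => // i; rewrite preimage_cst.
  by case: ifP.
(* Where the new candidate [x] is at least as good as the current choice. Splitting over the
   finitely many values of [sel] makes the set measurable. *)
pose B := \bigcup_(i in [set: I])
  (sel @^-1` [set i] `&` [set t | (F x t <= F i t)%E]).
have mB : measurable B.
  apply: fin_bigcup_measurable => // i _; apply: measurableI => //.
  by rewrite -[X in measurable X]setTI; exact: measurable_lee.
have BE t : B t <-> (F x t <= F (sel t) t)%E.
  split=> [[i _ [/= <-//]]|h]; by exists (sel t).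
exists (fun t => if t \in B then x else sel t) => [i|t i].
  rewrite (_ : _ @^-1` _ = (B `&` [set t | x = i]) `|`
      (~` B `&` sel @^-1` [set i])).
    apply: measurableU; last by apply: measurableI => //; exact: measurableC.
    apply: measurableI => //.
    have [->|/eqP xi] := eqVneq x i.
      by rewrite (_ : [set _ | _] = setT)//; apply/seteqP; split.
    by rewrite (_ : [set _ | _] = set0)//; apply/seteqP; split.
  apply/seteqP; split => t /=.
    case: ifPn; first by rewrite inE => ? <-; left.
    by rewrite notin_setE => ? <-; right.
  move=> [[Bt <-]|[Bt <-]]; first by rewrite mem_set.
  by rewrite memNset.
case: ifPn => [/set_mem/BE h|/negP Bt]; rewrite in_cons => /orP[/eqP ->//|/Fsel].
- by move=> /(_ t); exact: le_trans h.
- by rewrite leNgt; apply/negP => /ltW/BE/mem_set.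
- exact.
Qed.

End selector.

(** * Assouad's lemma *)

Section assouad.
Context {R : realType} (s : R) (s0 : s != 0) (n : nat) (J : finType).
Local Notation P := (rV_power (normal_prob 0 s) n).
Implicit Types t : {ffun J -> bool}.

Definition flip j t : {ffun J -> bool} := [ffun k => t k (+) (k == j)].

Lemma flipK j : involutive (flip j).
Proof. by move=> t; apply/ffunP => k; rewrite !ffunE addbK. Qed.

(** Decide each bit by the hypothesis [sel y] of smallest loss. The bound [D j] depends on the bit
    but not on [t], so averaging over [t] and pairing [t] with [flip j t] turns the risk into one
    two-point test per bit; some [t] is at least as bad as the average. *)
Lemma assouad (theta : {ffun J -> bool} -> 'rV[R]_n)
    (L : {ffun J -> bool} -> 'rV[R]_n -> \bar R) (k : R) (D : J -> R) :
  0 <= k ->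
  (forall t, measurable_fun setT (L t)) ->
  (forall t t' y, (L t' y <= L t y)%E ->
    ((k * \sum_j (t j != t' j)%:R)%:E <= L t y)%E) ->
  (forall t j, (\sum_i (theta t ord0 i - theta (flip j t) ord0 i) ^+ 2) / s ^+ 2
                 <= D j) ->
  exists t, ((k / 8 * \sum_j expR (- D j))%:E
    <= \int[P]_xi L t (theta t + xi)%R)%E.
Proof.
move=> k0 mL Lle DH.
have [sel msel selL] := measurable_argmin [ffun => false] mL.
pose A t j := [set y | t j != sel y j].
have mA t j : measurable (A t j).
  by rewrite (_ : A t j = sel @^-1` [set t' | t j != t' j])//; exact: msel.
have msh (c : 'rV[R]_n) (B : set 'rV[R]_n) : measurable B ->
    measurable ((fun x => c + x) @^-1` B).
  by move=> mB; rewrite -[X in measurable X]setTI; exact: measurable_rV_shift.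
pose p t j := fine (P ((fun x => theta t + x) @^-1` A t j)).
(* The decision on bit [j] is wrong for [flip j t] exactly when it is right for [t], so the two
   errors are those of a single test. *)
have pflip t j : expR (- D j) / 4 <= p t j + p (flip j t) j.
  have := two_point_test s0 (theta t) (theta (flip j t)) (mA t j).
  have -> : ~` A t j = A (flip j t) j.
    apply/seteqP; rewrite /A; split => y /=; rewrite !ffunE eqxx addbT.
      by move/negP; case: (t j); case: (sel y j).
    by move=> h; apply/negP; move: h; case: (t j); case: (sel y j).
  apply: le_trans; rewrite ler_wpM2r ?invr_ge0// ler_expR lerN2; exact: DH.
(* Minimality of [sel] supplies the premise of [Lle]; integrating the Hamming distance gives the sum
   of the error probabilities. *)
have risk_ge t : ((k * \sum_j p t j)%:E <= \int[P]_xi L t (theta t + xi)%R)%E.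
  rewrite EFinM -sumEFin.
  under eq_bigr => j _.
    rewrite /p fineK; last by apply: fin_num_measure; exact: msh.
    rewrite -[X in P X]setIT -(integral_indic P measurableT (msh _ _ (mA t j))).
    over.
  rewrite -ge0_integral_sum//; last first.
    by move=> j; apply: measurable_fun_EFin; apply: measurable_indic; exact: msh.
  rewrite -ge0_integralZl_EFin//; last 2 first.
  - by move=> x _; apply: sume_ge0.
  - apply: emeasurable_sum => j.
    by apply: measurable_fun_EFin; apply: measurable_indic; exact: msh.
  apply: ge0_le_integral => //.
  - by move=> x _; rewrite mule_ge0// sume_ge0.
  - apply: measurable_funeM; apply: emeasurable_sum => j.
    by apply: measurable_fun_EFin; apply: measurable_indic; exact: msh.
  - by apply: (measurableT_comp (mL t)); exact: measurable_rV_shift.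
  move=> x _; rewrite sumEFin -EFinM.
  apply: le_trans (Lle t (sel (theta t + x)) _ (selL _ _)).
  rewrite lee_fin ler_wpM2l// ler_sum// => j _.
  rewrite indicE; case: (boolP (_ \in _)) => [/set_mem|_]; last exact: ler0n.
  by rewrite /A/= => ->.
suff [t Ht] : exists t, (\sum_j expR (- D j)) / 8 <= \sum_j p t j.
  exists t; apply: le_trans (risk_ge t).
  by rewrite lee_fin mulrAC -mulrA ler_wpM2l.
apply: contrapT => /forallNP H.
have : \sum_t \sum_j p t j <
    \sum_(t : {ffun J -> bool}) (\sum_j expR (- D j)) / 8.
  apply: ltr_sum => [|t _].
    by apply/hasP; exists [ffun=> false]; rewrite ?mem_index_enum.
  by rewrite ltNge; apply/negP/H.
apply/negP; rewrite -leNgt exchange_big/=.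
under eq_bigr do rewrite mulr_suml.
rewrite exchange_big/=; apply: ler_sum => j _.
(* The involution [flip j] permutes the vertices. Halving the sum of the pairs turns the 1/4 of the
   test into 1/8. *)
have -> : \sum_t p t j = (\sum_t (p t j + p (flip j t) j)) / 2.
  rewrite big_split/= -(reindex_inj (inv_inj (flipK j)) (P := predT)
    (F := fun t => p t j))/=.
  lra.
rewrite ler_pdivlMr// mulr_suml; apply: ler_sum => t _.
by apply: le_trans (pflip t j); rewrite le_eqVlt; apply/orP; left; apply/eqP; field.
Qed.

End assouad.

(** * Balls with spikes *)

Section euclidean_facts.
Context {R : realType} {d : nat}.
Implicit Types x y u v : 'rV[R]_d.

Lemma dotrC x y : dotr x y = dotr y x.
Proof. by apply: eq_bigr => i _; rewrite mulrC. Qed.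

Lemma dotrDl x y u : dotr (x + y) u = dotr x u + dotr y u.
Proof. by rewrite -big_split; apply: eq_bigr => i _; rewrite mxE mulrDl. Qed.

Lemma dotrZl a x u : dotr (a *: x) u = a * dotr x u.
Proof. by rewrite [RHS]mulr_sumr; apply: eq_bigr => i _; rewrite mxE mulrA. Qed.

Lemma dotrZr a x u : dotr x (a *: u) = a * dotr x u.
Proof. by rewrite dotrC dotrZl dotrC. Qed.

Lemma dotrBB x y : dotr (x - y) (x - y) = dotr x x + dotr y y - 2 * dotr x y.
Proof.
rewrite mulr_sumr -big_split -sumrB; apply: eq_bigr => i _ /=.
by rewrite !mxE; ring.
Qed.

Lemma sqr_enorm x : enorm x ^+ 2 = dotr x x.
Proof. by rewrite sqr_sqrtr// dotr_ge0. Qed.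

Lemma enorm_ge0 x : 0 <= enorm x.
Proof. exact: sqrtr_ge0. Qed.

Lemma enormZ a x : enorm (a *: x) = `|a| * enorm x.
Proof.
by rewrite /enorm dotrZl dotrZr mulrA -expr2 sqrtrM ?sqr_ge0// sqrtr_sqr.
Qed.

Lemma sphere_dotr u : sphere d u -> dotr u u = 1.
Proof. by move=> Su; rewrite -sqr_enorm Su expr1n. Qed.

(** Cauchy-Schwarz, from the squared length of the component of [x] orthogonal to [u]. *)
Lemma dotr_le_enorm x u : sphere d u -> dotr x u <= enorm x.
Proof.
move=> Su; have := dotr_ge0 (x - dotr x u *: u).
rewrite dotrBB -sqr_enorm !dotrZl !dotrZr sphere_dotr// => h.
have : dotr x u ^+ 2 <= enorm x ^+ 2 by nra.
rewrite -ler_sqrt ?sqr_ge0// !sqrtr_sqr (ger0_norm (enorm_ge0 x)).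
by apply: le_trans; rewrite ler_norm.
Qed.

Lemma direction_sphere x : 0 < enorm x -> sphere d (direction x).
Proof.
by move=> x0; rewrite /sphere/= enormZ gtr0_norm ?invr_gt0// mulVf// gt_eqF.
Qed.

Lemma dotr_direction x : dotr x (direction x) = enorm x.
Proof.
rewrite /direction dotrZr -sqr_enorm expr2.
have [->|x0] := eqVneq (enorm x) 0; first by rewrite !mulr0.
by rewrite mulKf.
Qed.

Lemma coord_le_enorm x i : `|x ord0 i| <= enorm x.
Proof.
rewrite -[leLHS]ger0_norm// -sqrtr_sqr ler_sqrt; last exact: dotr_ge0.
rewrite real_normK ?num_real// /dotr (bigD1 i)//= -expr2 lerDl sumr_ge0// => j _.
by rewrite -expr2 sqr_ge0.
Qed.

Lemma continuous_dotr u : continuous (fun x => dotr x u).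
Proof.
suff H (s : seq 'I_d) :
    continuous (fun x : 'rV[R]_d => \sum_(i <- s) x ord0 i * u ord0 i) by exact: H.
elim: s => [|i s IH] x.
  rewrite (_ : (fun _ => _) = cst 0); first exact: cst_continuous.
  by apply/funext => y; rewrite big_nil.
rewrite (_ : (fun _ => _) = (fun y : 'rV[R]_d => y ord0 i * u ord0 i) \+
    (fun y => \sum_(i <- s) y ord0 i * u ord0 i)); last first.
  by apply/funext => y; rewrite big_cons.
apply: continuousD; last exact: IH.
have h : continuous (fun y : 'rV[R]_d => y ord0 i) by exact: coord_continuous.
apply: continuousM; [exact: h|exact: cst_continuous].
Qed.

Lemma measurable_dotr u : measurable_fun setT (fun x => dotr u x).
Proof.
apply: measurable_sum => i; apply: measurable_funM => //.
exact: measurable_rV_coord.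
Qed.

End euclidean_facts.

Section spiked_ball.
Context {R : realType} {d : nat} (J : finType) (v : J -> 'rV[R]_d) (e r : R).
Hypotheses (vS : forall j, sphere d (v j)) (e0 : 0 <= e) (r0 : 0 < r).

(** The amount by which the point (1 + e) v_j raises the support function of the unit ball; it is
    positive exactly on the cap <v_j, u> > 1 / (1 + e). *)
Definition spike (j : J) (u : 'rV[R]_d) : R :=
  Num.max 0 ((1 + e) * dotr (v j) u - 1).

Hypothesis disj : forall u j k, sphere d u ->
  0 < spike j u -> 0 < spike k u -> j = k.

Lemma spike_ge0 j u : 0 <= spike j u.
Proof. by rewrite le_max lexx. Qed.

Lemma spike_le j u : sphere d u -> spike j u <= e.
Proof.
move=> Su; rewrite ge_max e0/=.
have : dotr (v j) u <= 1 by rewrite -(vS j); exact: dotr_le_enorm.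
by move=> h; have := ler_wpM2l (addr_ge0 ler01 e0) h; lra.
Qed.

Lemma spike_sumP (a : J -> R) u : sphere d u ->
  (\sum_j a j * spike j u = 0 /\ forall j, spike j u = 0) \/
  exists j, 0 < spike j u /\ (\sum_k a k * spike k u = a j * spike j u).
Proof.
move=> Su; case: (pselect (exists j, 0 < spike j u)) => [[j bj]|nb].
  right; exists j; split => //; rewrite (bigD1 j)//= big1 ?addr0// => k kj.
  have [bk|] := ltP 0 (spike k u); first by rewrite (disj Su bk bj) eqxx in kj.
  move=> bk; rewrite (_ : spike k u = 0) ?mulr0//.
  by apply/le_anti; rewrite bk spike_ge0.
left; have b0 j : spike j u = 0.
  apply/le_anti; rewrite spike_ge0 andbT leNgt; apply/negP => bj; apply: nb.
  by exists j.
by split => //; apply: big1 => j _; rewrite b0 mulr0.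
Qed.

Definition spiked_support (t : {ffun J -> bool}) (u : 'rV[R]_d) : R :=
  r * (1 + \sum_j (t j)%:R * spike j u).

(** As an intersection of half-spaces (a Wulff shape), the body is closed and convex by
    construction. What remains to be shown is that no half-space is redundant, see
    [support_spiked_ball]. *)
Definition spiked_ball (t : {ffun J -> bool}) : set 'rV[R]_d :=
  [set x | forall u, sphere d u -> dotr x u <= spiked_support t u].

Lemma spiked_support_ge t u : r <= spiked_support t u.
Proof.
rewrite /spiked_support -[leLHS]mulr1 ler_pM2l// lerDl sumr_ge0// => j _.
by rewrite mulr_ge0// spike_ge0.
Qed.

Lemma spiked_support_le t u : sphere d u -> spiked_support t u <= r * (1 + e).
Proof.
move=> Su; rewrite /spiked_support ler_pM2l// lerD2l.
have [[-> _]//|[j [_ ->]]] := spike_sumP (fun j => (t j)%:R) Su.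
apply: le_trans (spike_le j Su).
by case: (t j); rewrite ?mul1r// mul0r spike_ge0.
Qed.

Lemma eball_sub_spiked_ball t : eball d r `<=` spiked_ball t.
Proof.
move=> x xr u Su; apply: le_trans (dotr_le_enorm x Su) _.
exact: le_trans (spiked_support_ge t u).
Qed.

Lemma support_spiked_ball t u : sphere d u ->
  support_fun (spiked_ball t) u = spiked_support t u.
Proof.
move=> Su.
have ub : ubound [set dotr x u | x in spiked_ball t] (spiked_support t u).
  by move=> _ [x Kx <-]; exact: Kx.
have ru : spiked_ball t (r *: u).
  by apply: eball_sub_spiked_ball; rewrite /eball/= enormZ Su mulr1 gtr0_norm.
have hs : has_sup [set dotr x u | x in spiked_ball t].
  split; first by exists (dotr (r *: u) u); exists (r *: u).
  by exists (spiked_support t u).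
apply/le_anti/andP; split; first by apply: ge_sup => //; case: hs.
suff [x Kx <-] : exists2 x, spiked_ball t x & dotr x u = spiked_support t u.
  by apply: sup_upper_bound => //; exists x.
have ball_case : spiked_support t u = r ->
    exists2 x, spiked_ball t x & dotr x u = spiked_support t u.
  by move=> ->; exists (r *: u) => //; rewrite dotrZl sphere_dotr// mulr1.
have [[E _]|[j [bj E]]] := spike_sumP (fun j => (t j)%:R) Su.
  by apply: ball_case; rewrite /spiked_support E addr0 mulr1.
have [tj|tj] := boolP (t j); last first.
  by apply: ball_case; rewrite /spiked_support E (negbTE tj) mul0r addr0 mulr1.
(* On the cap of an active spike the supremum is attained at its tip. The tip satisfies every
   constraint, since r (1 + e) <v_j, w> = r (1 + ((1 + e) <v_j, w> - 1)) and the inner bracket is at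
   most [spike j w]. *)
exists ((r * (1 + e)) *: v j).
  move=> w Sw; rewrite dotrZl -mulrA /spiked_support ler_pM2l// -lerBlDl.
  rewrite (bigD1 j)//= tj mul1r.
  apply: (@le_trans _ _ (spike j w)); first by rewrite le_max lexx orbT.
  by rewrite lerDl sumr_ge0// => k _; rewrite mulr_ge0// spike_ge0.
rewrite dotrZl /spiked_support E tj mul1r -mulrA; congr (_ * _).
move: bj; rewrite /spike lt_max ltxx/= => bj.
by rewrite max_r ?ltW// addrCA subrr addr0.
Qed.

Lemma spiked_ball_sub t : spiked_ball t `<=` eball d (r * (1 + e)).
Proof.
move=> x Kx; have [x0|x0] := ltP 0 (enorm x); last first.
  by apply: (le_trans x0); rewrite mulr_ge0 ?addr_ge0// ltW.
rewrite /eball/= -dotr_direction; have Sx := direction_sphere x0.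
exact: le_trans (Kx _ Sx) (spiked_support_le t Sx).
Qed.

Lemma spiked_ball_convex_body t : convex_body (spiked_ball t).
Proof.
split.
- apply: bounded_closed_compact.
    exists (r * (1 + e)); split; first exact: num_real.
    move=> M rM x Kx; have xM := le_trans (spiked_ball_sub Kx) (ltW rM).
    rewrite /Num.norm/=.
    have [->|/mx_norm_neq0[[i j] ->]] := eqVneq (mx_norm x) 0.
      exact: le_trans (enorm_ge0 x) xM.
    by rewrite (ord1 i); exact: le_trans (coord_le_enorm x _) xM.
  rewrite (_ : spiked_ball t = \bigcap_(u in sphere d)
      ((fun x => dotr x u) @^-1` [set y | y <= spiked_support t u])); last first.
    by apply/seteqP; split.
  apply: closed_bigI => u _; apply: closed_comp; last exact: closed_le.
  by move=> x _; exact: continuous_dotr.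
- move=> x y l; rewrite !inE => Kx Ky u Su.
  rewrite [dotr _ _]dotrDl !dotrZl.
  have l0 : 0 <= l%:num by [].
  have l1 : l%:num <= 1 by [].
  have := Kx u Su; have := Ky u Su.
  rewrite /unstable.onem.
  move: (dotr x u) (dotr y u) (spiked_support t u) => a b c.
  nra.
(* Neighbourhoods are sup-norm balls: radius r / (d + 1) fits into the Euclidean ball of radius r
   because d <= (d + 1)^2, and it makes sense for d = 0 too. *)
- exists 0; apply/nbhs_ballP; exists (r / d.+1%:R).
    by rewrite /= divr_gt0// ltr0n.
  move=> x [_ bx]; apply: eball_sub_spiked_ball.
  rewrite /eball/= -[leRHS]gtr0_norm// -sqrtr_sqr ler_sqrt ?sqr_ge0//.
  apply: (@le_trans _ _ (\sum_(i < d) (r / d.+1%:R) ^+ 2)).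
    apply: ler_sum => i _; have := bx ord0 i.
    rewrite /ball/= mxE sub0r normrN => h.
    rewrite -expr2 -real_normK ?num_real// ler_sqr ?nnegrE// ?ltW//.
    by rewrite divr_gt0// ltr0n.
  rewrite sumr_const card_ord -[leLHS]mulr_natr exprMn -mulrA.
  apply: ler_piMr; first exact: sqr_ge0.
  rewrite exprVn ler_pdivrMl ?exprn_gt0 ?ltr0n// mulr1 -natrX ler_nat.
  by rewrite (leq_trans (leqnSn d))// leq_pmulr.
Qed.

End spiked_ball.

(** * A grid of directions *)

Section grid.
Context {R : realType} (D m : nat).
Hypothesis m0 : (0 < m)%N.
Local Notation dR := (D.+1%:R : R).
Local Notation J := {ffun 'I_D -> 'I_m}.
Implicit Types (k l : J).

Lemma dotr_recl (x y : 'rV[R]_D.+1) : dotr x y =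
  x ord0 ord0 * y ord0 ord0 + \sum_j x ord0 (lift ord0 j) * y ord0 (lift ord0 j).
Proof. by rewrite /dotr big_ord_recl. Qed.

(** Central projection of the hyperplane x_0 = 1 onto the sphere does not increase distances: with
    norms a, b >= 1 and q = |w - w'|^2, the claim reduces to (a - b)^2 + q (a b - 1) >= 0. *)
Lemma dotr_direction_ge (w w' : 'rV[R]_D.+1) :
  w ord0 ord0 = 1 -> w' ord0 ord0 = 1 ->
  1 - dotr (w - w') (w - w') / 2 <= dotr (direction w) (direction w').
Proof.
move=> w1 w1'.
have norm1 (z : 'rV[R]_D.+1) : z ord0 ord0 = 1 -> 1 <= enorm z.
  by move=> z1; have := coord_le_enorm z ord0; rewrite z1 normr1.
have := dotr_ge0 (w - w'); have := norm1 _ w1; have := norm1 _ w1'.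
rewrite /direction dotrZl dotrZr dotrBB -!sqr_enorm.
move: (enorm w) (enorm w') (dotr w w') => a b s b1 a1 q0.
have ab1 : 1 <= a * b by rewrite mulr_ege1.
have ab0 : 0 < a * b by rewrite mulr_gt0// (lt_le_trans ltr01).
have -> : a^-1 * (b^-1 * s) = s / (a * b) by rewrite invfM mulrA mulrC.
rewrite ler_pdivlMr//.
have := ler_wpM2l q0 ab1; have := sqr_ge0 (a - b); lra.
Qed.

Lemma directionZ c (x : 'rV[R]_D.+1) : 0 < c -> direction (c *: x) = direction x.
Proof.
move=> c0; rewrite /direction enormZ gtr0_norm// scalerA invfM mulrAC.
by rewrite mulVf ?gt_eqF// mul1r.
Qed.

(** Points (1, k / m) of the affine chart x_0 = 1. Here [D] is d - 1, so the grid has m^(d-1)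
    points, with chart coordinates in [0, 1). *)
Definition grid_chart (k : J) : 'rV[R]_D.+1 :=
  \row_i if unlift ord0 i is Some j then (k j)%:R / m%:R else 1.

Lemma grid_chart0 k : grid_chart k ord0 ord0 = 1.
Proof. by rewrite mxE unlift_none. Qed.

Lemma grid_chartS k j : grid_chart k ord0 (lift ord0 j) = (k j)%:R / m%:R.
Proof. by rewrite mxE liftK. Qed.

Lemma grid_chart01 k j : 0 <= (k j)%:R / m%:R :> R /\ (k j)%:R / m%:R <= 1 :> R.
Proof.
split; first by rewrite divr_ge0.
by rewrite ler_pdivrMr ?ltr0n// mul1r ler_nat ltnW.
Qed.

Definition grid_dir (k : J) : 'rV[R]_D.+1 := direction (grid_chart k).

Lemma enorm_grid_chart_ge1 k : 1 <= enorm (grid_chart k).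
Proof.
by have := coord_le_enorm (grid_chart k) ord0; rewrite grid_chart0 normr1.
Qed.

Lemma sqr_enorm_grid_chart_le k : enorm (grid_chart k) ^+ 2 <= dR.
Proof.
rewrite sqr_enorm dotr_recl grid_chart0 mulr1 -natr1 addrC lerD2r.
apply: (@le_trans _ _ (\sum_(j < D) 1)); last by rewrite sumr_const card_ord.
apply: ler_sum => j _; rewrite grid_chartS.
have [a0 a1] := grid_chart01 k j.
by rewrite mulr_ile1.
Qed.

Lemma sphere_grid_dir k : sphere D.+1 (grid_dir k).
Proof.
by apply: direction_sphere; exact: lt_le_trans (enorm_grid_chart_ge1 k).
Qed.

(* Small enough for the caps [{u | <v, u> > 1 / (1 + grid_eps)}] around distinct
   grid directions v to be disjoint. *)
Definition grid_eps : R := (64 * dR ^+ 2 * m%:R ^+ 2)^-1.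

Lemma grid_eps_gt0 : 0 < grid_eps.
Proof. by rewrite invr_gt0 !mulr_gt0 ?exprn_gt0 ?ltr0n. Qed.

Lemma grid_eps_le1 : grid_eps <= 1.
Proof.
rewrite invf_le1 ?mulr_gt0// ?exprn_gt0 ?ltr0n//.
by rewrite -!natrX -!natrM ler1n !muln_gt0 m0.
Qed.

Local Notation gspike := (spike grid_dir grid_eps).

(** Suppose coordinate [i] differs. A common [u] forces a^2 (w - w')^2 < 16 eps, where w, w' are the
    chart coordinates and a is an inverse chart norm; but |w - w'| >= 1/m and a^2 >= 1/d make it at
    least 64 eps. *)
Lemma grid_disjoint u (j k : J) : sphere D.+1 u ->
  0 < gspike j u -> 0 < gspike k u -> j = k.
Proof.
move=> Su bj bk; apply/ffunP => i; apply/val_inj/eqP; apply: contraT => jk.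
(* On the unit sphere |v - u|^2 = 2 - 2 <v, u>, and <v, u> > 1 / (1 + eps) >= 1 - eps. Only
   coordinates 0 and [i] of the difference are kept. *)
have close l : 0 < gspike l u ->
    (grid_dir l ord0 ord0 - u ord0 ord0) ^+ 2 +
    (grid_dir l ord0 (lift ord0 i) - u ord0 (lift ord0 i)) ^+ 2 < 2 * grid_eps.
  rewrite /spike lt_max ltxx/= => h.
  apply: (@le_lt_trans _ _ (dotr (grid_dir l - u) (grid_dir l - u))).
    rewrite dotr_recl (bigD1 i)//= !mxE -!expr2 lerD2l lerDl sumr_ge0// => ? _.
    by rewrite -expr2 sqr_ge0.
  rewrite dotrBB !sphere_dotr//; last exact: sphere_grid_dir.
  have := dotr_le_enorm (grid_dir l) Su; rewrite (sphere_grid_dir l).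
  have := grid_eps_gt0; move: h; move: (dotr _ _) grid_eps => s e; nra.
have := close _ bj; have := close _ bk.
rewrite /grid_dir /direction !mxE !unlift_none !liftK !mulr1.
have [w0 w1] := grid_chart01 k i.
have dm : (m%:R ^-2 : R) <= ((j i)%:R / m%:R - (k i)%:R / m%:R) ^+ 2.
  rewrite -mulrBl exprMn exprVn ler_peMl ?invr_ge0 ?sqr_ge0//.
  have -> : ((j i)%:R - (k i)%:R : R) ^+ 2 = (((j i)%:Z - (k i)%:Z) ^+ 2)%:~R.
    by rewrite rmorphXn/= rmorphB.
  rewrite ler1z -gtz0_ge1 exprn_even_gt0//= subr_eq0 eqz_nat//.
have a0 := lt_le_trans ltr01 (enorm_grid_chart_ge1 j).
have ad := sqr_enorm_grid_chart_le j.
have ad' : dR^-1 <= (enorm (grid_chart j))^-1 ^+ 2.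
  by rewrite exprVn lef_pV2// posrE ?exprn_gt0// ltr0n.
have e1 : grid_eps = (m%:R ^- 2 * dR^-1) / (64 * dR).
  rewrite /grid_eps; field; rewrite !gt_eqF ?ltr0n//.
have md0 : 0 < (m%:R ^- 2 * dR^-1 : R).
  by rewrite mulr_gt0 ?invr_gt0 ?exprn_gt0 ?ltr0n.
have e2 : 64 * grid_eps <= m%:R ^- 2 * dR^-1.
  rewrite e1 mulrCA; apply: ler_piMr; first exact: ltW.
  rewrite ler_pdivrMr ?mulr_gt0 ?ltr0n// mul1r; apply: ler_peMr => //.
  by rewrite ler1n.
have h3 : m%:R ^- 2 * dR^-1 <=
   (((j i)%:R / m%:R - (k i)%:R / m%:R) * (enorm (grid_chart j))^-1) ^+ 2.
  by rewrite exprMn ler_pM// ?invr_ge0 ?exprn_ge0.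
move: h3 e2 md0 w0 w1.
move: (m%:R ^- 2 * dR^-1) grid_eps ((j i)%:R / m%:R) ((k i)%:R / m%:R) => q e w w'.
move: (enorm _)^-1 (enorm _)^-1 (u _ _) (u _ _) => b a u1 u0.
move=> h3 e2 q0 w0 w1 hk hj.
(* Comparison through [u], by (x + y)^2 <= 2 x^2 + 2 y^2. Coordinate 0 controls the normalising
   factors, which [h2] needs to pass from a w - b w' to a (w - w'). *)
have h1 : (a - b) ^+ 2 + (a * w - b * w') ^+ 2 < 8 * e.
  have i1 : (a - b) ^+ 2 <= 2 * (a - u0) ^+ 2 + 2 * (b - u0) ^+ 2.
    by have := sqr_ge0 (a - u0 + (b - u0)); lra.
  have i2 : (a * w - b * w') ^+ 2 <= 2 * (a * w - u1) ^+ 2 + 2 * (b * w' - u1) ^+ 2.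
    by have := sqr_ge0 (a * w - u1 + (b * w' - u1)); lra.
  lra.
have h2 : ((w - w') * a) ^+ 2 <= 2 * (a * w - b * w') ^+ 2 + 2 * (w' * (b - a)) ^+ 2.
  by have := sqr_ge0 ((a * w - b * w') - w' * (b - a)); lra.
have h4 : (w' * (b - a)) ^+ 2 <= (a - b) ^+ 2.
  rewrite -[leRHS]mul1r -[X in _ <= _ * X]sqrrN opprB exprMn ler_wpM2r ?sqr_ge0//.
  by rewrite exprn_ile1.
lra.
Qed.

(* Directions whose chart coordinates are within [grid_delta] of those of v
   satisfy [<v, u> >= 1 - grid_eps / 8]. *)
Definition grid_delta : R := (16 * dR ^+ 2 * m%:R)^-1.

Lemma grid_spike_ge (k : J) (x : 'rV[R]_D.+1) : 0 < x ord0 ord0 ->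
  (forall j, `|x ord0 (lift ord0 j) / x ord0 ord0 - (k j)%:R / m%:R|
     <= grid_delta) ->
  grid_eps / 2 <= gspike k (direction x).
Proof.
move=> x0 H; rewrite -(directionZ x (c := (x ord0 ord0)^-1)) ?invr_gt0//.
set w := _ *: x.
have w0 : w ord0 ord0 = 1 by rewrite mxE mulVf// gt_eqF.
have := dotr_direction_ge (grid_chart0 k) w0.
have q : dotr (grid_chart k - w) (grid_chart k - w) <= grid_eps / 4.
  rewrite dotr_recl !mxE unlift_none mulVf ?gt_eqF// subrr mul0r add0r.
  apply: (@le_trans _ _ (\sum_(j < D) grid_delta ^+ 2)).
    apply: ler_sum => j _; rewrite !mxE liftK -expr2 -[leLHS]real_normK ?num_real//.
    rewrite ler_sqr ?nnegrE// ?(le_trans (normr_ge0 _) (H j))//.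
    by rewrite -normrN opprB [_^-1 * _]mulrC.
  rewrite sumr_const card_ord -[leLHS]mulr_natr.
  have -> : grid_delta ^+ 2 = grid_eps / 4 * dR^-1 ^+ 2.
    rewrite /grid_delta /grid_eps; field; rewrite !gt_eqF ?ltr0n//.
  rewrite -mulrA; apply: ler_piMr; first by rewrite divr_ge0// ltW// grid_eps_gt0.
  rewrite exprVn ler_pdivrMl ?exprn_gt0 ?ltr0n// mulr1 -natrX ler_nat.
  by rewrite (leq_trans (leqnSn D))// leq_pmulr.
rewrite le_max -/(grid_dir k) => h; apply/orP; right.
(* (1 + eps) (1 - eps / 8) - 1 >= 3 eps / 4 as eps <= 1. *)
have := grid_eps_gt0; have := grid_eps_le1.
move: h q; move: (dotr _ _) (dotr _ _) grid_eps => p s e; nra.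
Qed.

End grid.

(** * Surface measure of caps *)

Section lebesgue_box.
Context {R : realType}.
Local Notation mu := (@lebesgue_measure R).

Lemma measurable_box n (l h : 'I_n -> R) :
  measurable [set y : 'rV[R]_n | forall j, l j <= y ord0 j <= h j].
Proof.
rewrite (_ : mkset _ = \bigcap_(j in [set: 'I_n])
    ((fun y : 'rV[R]_n => y ord0 j) @^-1` `[l j, h j]%classic)); last first.
  apply/seteqP; split => [y H j _|y H j]; first by rewrite /= in_itv/=; exact: H.
  by have := H j Logic.I; rewrite /= in_itv.
apply: fin_bigcap_measurable => // j _.
by rewrite -[X in measurable X]setTI; exact: measurable_rV_coord.
Qed.

Lemma lebesgue_box n (l : 'I_n -> R) (h : R) : 0 <= h ->
  rV_power mu n [set y : 'rV[R]_n | forall j, l j <= y ord0 j <= l j + h] =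
  (h ^+ n)%:E.
Proof.
move=> h0; elim: n l => [|n IH] l.
  rewrite /= diracE mem_set//= => j; by case: j.
rewrite /= /pushforward (_ : _ @^-1` _ = `[l ord0, l ord0 + h] `*`
   [set y : 'rV[R]_n | forall j, l (lift ord0 j) <= y ord0 j <= l (lift ord0 j) + h]).
  rewrite product_measure1E//; last exact: measurable_box.
  rewrite [X in (_ * X)%E](IH (fun j => l (lift ord0 j))).
  rewrite [X in (X * _)%E](@lebesgue_measure_itv R `[l ord0, l ord0 + h])/=.
  rewrite lte_fin ltrDl.
  case: ltP => h0'; first by rewrite -EFinD addrAC subrr add0r -EFinM exprS.
  by rewrite (_ : h = 0) ?mul0e ?expr0n//; apply/le_anti; rewrite h0'.
apply/seteqP; split => -[x y] /=.
  move=> H; split; first by have := H ord0; rewrite rV_cons_ord0 in_itv.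
  by move=> j; have := H (lift ord0 j); rewrite rV_cons_lift.
move=> [H0 H] i; case: (unliftP ord0 i) => [j|] ->.
  by rewrite rV_cons_lift; exact: H.
by rewrite rV_cons_ord0; move: H0; rewrite in_itv.
Qed.

Lemma measurable_ler_set d (T : measurableType d) (f g : T -> R) :
  measurable_fun setT f -> measurable_fun setT g ->
  measurable [set x | f x <= g x].
Proof.
move=> mf mg.
rewrite (_ : mkset _ = setT `&` [set x | ((f x)%:E <= (g x)%:E)%E]); last first.
  by rewrite setTI; apply/seteqP; split => x /=; rewrite lee_fin.
by apply: measurable_lee => //; exact: measurable_fun_EFin.
Qed.

(** The slab a <= x_0 <= b of the cone over the cube w + [0, h]^n in the chart x_0 = 1. *)
Definition cube_cone n (w : 'I_n -> R) (a b h : R) : set 'rV[R]_n.+1 :=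
  [set x | a <= x ord0 ord0 <= b /\ forall j, w j * x ord0 ord0 <=
     x ord0 (lift ord0 j) <= (w j + h) * x ord0 ord0].

Lemma measurable_cube_cone n (w : 'I_n -> R) a b h :
  measurable (cube_cone w a b h).
Proof.
rewrite (_ : cube_cone w a b h = [set x : 'rV[R]_n.+1 | a <= x ord0 ord0] `&`
  [set x : 'rV[R]_n.+1 | x ord0 ord0 <= b] `&`
  \bigcap_(j in [set: 'I_n]) ([set x : 'rV[R]_n.+1 | w j * x ord0 ord0 <=
      x ord0 (lift ord0 j)] `&` [set x : 'rV[R]_n.+1 |
      x ord0 (lift ord0 j) <= (w j + h) * x ord0 ord0])).
  have mc i := @measurable_rV_coord R n.+1 i.
  apply: measurableI.
    by apply: measurableI; apply: measurable_ler_set.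
  apply: fin_bigcap_measurable => // j _.
  by apply: measurableI; apply: measurable_ler_set => //; apply: measurable_funM.
apply/seteqP; split => x /=.
  move=> [/andP[ax xb] H]; split => // j _ /=.
  by have /andP[] := H j.
move=> [[ax xb] H]; split => [|j]; first by rewrite ax xb.
by have [/= l1 l2] := H j Logic.I; rewrite l1 l2.
Qed.

(* Fubini over the first coordinate: the cross-section at height x is a cube of
   side x h. *)
Lemma lebesgue_cube_cone_ge n (w : 'I_n -> R) a b h :
  0 < a -> a <= b -> 0 <= h ->
  (((b - a) * (a * h) ^+ n)%:E <= lebesgue_rV n.+1 (cube_cone w a b h))%E.
Proof.
move=> a0 ab h0; rewrite /lebesgue_rV /= /pushforward /product_measure1.
set C := _ @^-1` _.
have mC : measurable C.
  rewrite /C -[X in measurable X]setTI; apply: measurable_rV_cons => //.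
  exact: measurable_cube_cone.
apply: (@le_trans _ _ (\int[mu]_(x in `[a, b]) ((a * h) ^+ n)%:E)%E).
  rewrite integral_cst//= lebesgue_measure_itv/= lte_fin.
  case: ltP => ab'; first by rewrite -EFinD -EFinM mulrC.
  by rewrite (_ : b = a) ?subrr ?mul0r ?mule0//; apply/le_anti; rewrite ab ab'.
apply: (@le_trans _ _ (\int[mu]_(x in `[a, b]) (rV_power mu n (xsection C x)))%E).
  apply: ge0_le_integral => //.
  - by move=> x _; rewrite lee_fin exprn_ge0// mulr_ge0// ltW.
  - apply: measurable_funTS; exact: (measurable_fun_xsection (rV_power mu n) mC).
  move=> x; rewrite /= in_itv/= => /andP[ax xb].
  rewrite (_ : xsection C x = [set y : 'rV[R]_n |
      forall j, w j * x <= y ord0 j <= w j * x + h * x]).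
    have x0 : 0 <= x by rewrite (le_trans _ ax)// ltW.
    rewrite lebesgue_box ?mulr_ge0// lee_fin; apply: lerXn2r.
    - by rewrite nnegrE mulr_ge0// ltW.
    - by rewrite nnegrE mulr_ge0.
    - by rewrite mulrC ler_wpM2l.
  apply/seteqP; split => y; rewrite /xsection/= inE /C /cube_cone/=.
    move=> [_ H] j; have := H j.
    by rewrite rV_cons_lift !rV_cons_ord0/= mulrDl.
  move=> H; rewrite rV_cons_ord0 ax xb; split => // j; rewrite rV_cons_lift/= mulrDl.
  exact: H.
apply: ge0_subset_integral => //.
exact: (measurable_fun_xsection (rV_power mu n) mC).
Qed.

End lebesgue_box.

Section grid_surface.
Context {R : realType} (D m : nat).
Hypothesis m0 : (0 < m)%N.
Local Notation dR := (D.+1%:R : R).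
Local Notation J := {ffun 'I_D -> 'I_m}.
Local Notation gspike := (spike (@grid_dir R D m) (@grid_eps R D m)).

Definition grid_cap (k : J) : set 'rV[R]_D.+1 :=
  sphere D.+1 `&` [set u | grid_eps D m / 2 <= gspike k u].

Lemma measurable_grid_cap k : measurable (grid_cap k).
Proof.
apply: measurableI; first exact: measurable_sphere.
apply: measurable_ler_set => //.
apply: measurable_maxr => //; apply: measurable_funB => //.
by apply: measurable_funM => //; exact: measurable_dotr.
Qed.

(** The volume bound a (a h)^D for a truncated cone, with a = 1 / (4 d) and h = [grid_delta], freed
    of its factor m^-D. *)
Definition cap_const : R := (4 * dR)^-1 * (64 * dR ^+ 3)^-1 ^+ D.

Lemma cap_const_gt0 : 0 < cap_const.
Proof. by rewrite mulr_gt0 ?exprn_gt0 ?invr_gt0 ?mulr_gt0 ?exprn_gt0 ?ltr0n. Qed.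

(** Surface measure is d times the volume of the cone over the cap inside the unit ball. That cone
    contains a truncated cone over a chart cube of side [grid_delta]; the factor d >= 1 is
    dropped. *)
Lemma surface_grid_cap_ge k :
  ((cap_const / m%:R ^+ D)%:E <= surface_measure D.+1 (grid_cap k))%E.
Proof.
have d0 : 0 < dR by rewrite ltr0n.
have d1 : 1 <= dR by rewrite ler1n.
have mR0 : 0 < m%:R :> R by rewrite ltr0n.
have m1 : 1 <= m%:R :> R by rewrite ler1n.
(* Chart coordinates in the cube are at most 2, so at height at most b the squared norm is at most
   b^2 + 4 D b^2 <= 4 d b^2 = 1 / d. Taking a = b / 2 gives b - a = a. *)
pose a := (4 * dR)^-1; pose b := (2 * dR)^-1; pose h := @grid_delta R D m.
have a0 : 0 < a by rewrite invr_gt0 mulr_gt0.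
have h0 : 0 < h by rewrite invr_gt0 !mulr_gt0.
have h1 : h <= 1.
  by rewrite invf_le1 ?mulr_gt0// -natrX -!natrM ler1n !muln_gt0 m0.
have ab2 : b = a + a by rewrite /a /b; field; rewrite gt_eqF.
have aba : b - a = a by rewrite ab2 addrK.
have ab : a <= b by rewrite ab2 lerDl ltW.
have := lebesgue_cube_cone_ge (fun j => (k j)%:R / m%:R) a0 ab (ltW h0).
rewrite aba (_ : a * (a * h) ^+ D = cap_const / m%:R ^+ D); last first.
  rewrite /cap_const -exprVn -mulrA -exprMn; congr (_ * _ ^+ _).
  by rewrite /a /h /grid_delta; field; rewrite !gt_eqF.
move=> H; apply: (le_trans H); rewrite /surface_measure.
set V := lebesgue_rV D.+1 _; set W := lebesgue_rV D.+1 _.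
have VW : (V <= W)%E.
  have mW : measurable
      ([set x : 'rV[R]_D.+1 | grid_cap k (direction x)] `&` eball D.+1 1).
    apply: measurableI; last exact: measurable_eball.
    rewrite -[X in measurable X]setTI; apply: measurable_direction => //.
    exact: measurable_grid_cap.
  apply: le_measure; rewrite ?inE//; first exact: measurable_cube_cone.
  move=> x [/andP[ax xb] Hx].
  have x0 : 0 < x ord0 ord0 by exact: lt_le_trans ax.
  have Hj j : 0 <= x ord0 (lift ord0 j) / x ord0 ord0 - (k j)%:R / m%:R <= h.
    have /andP[l1 l2] := Hx j.
    by rewrite subr_ge0 ler_pdivlMr// l1/= lerBlDl ler_pdivrMr.
  have b0 : 0 < b := lt_le_trans a0 ab.
  have nx : 0 < enorm x.
    by apply: (lt_le_trans x0); apply: le_trans (ler_norm _) (coord_le_enorm x ord0).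
  split; first split => /=.
  - exact: direction_sphere.
  - apply: grid_spike_ge => // j; have /andP[l1 l2] := Hj j.
    by rewrite ger0_norm.
  rewrite /eball/= -sqrtr1 ler_sqrt// dotr_recl.
  apply: (@le_trans _ _ (b ^+ 2 + \sum_(j < D) (2 * b) ^+ 2)).
    apply: lerD; first by rewrite -expr2 ler_sqr// nnegrE ltW.
    apply: ler_sum => j _; have /andP[l1 l2] := Hj j.
    have [w0 w1] := @grid_chart01 R D m m0 k j.
    have e : x ord0 (lift ord0 j) =
        x ord0 (lift ord0 j) / x ord0 ord0 * x ord0 ord0.
      by rewrite divfK// gt_eqF.
    have y0 : 0 <= x ord0 (lift ord0 j) / x ord0 ord0 by lra.
    have y2 : x ord0 (lift ord0 j) / x ord0 ord0 <= 2 by lra.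
    rewrite -expr2 e; apply: lerXn2r.
    - by rewrite nnegrE mulr_ge0// ltW.
    - by rewrite nnegrE mulr_ge0// ltW.
    - by rewrite ler_pM// ltW.
  rewrite sumr_const card_ord -[X in _ + X <= _]mulr_natl.
  have b20 : 0 <= b ^+ 2 by rewrite sqr_ge0.
  have : b ^+ 2 * (4 * dR) <= 1.
    rewrite /b exprVn ler_pdivrMl ?exprn_gt0 ?mulr_gt0// mulr1.
    by move: d1; move: dR => z; nra.
  have -> : dR = D%:R + 1 by rewrite natr1.
  move: b20; rewrite exprMn; move: (b ^+ 2) (D%:R : R) => b2 z. lra.
apply: (le_trans VW).
rewrite -[leLHS]mul1e; apply: lee_wpmul2r; first exact: measure_ge0.
exact: (lee_tofin d1).
Qed.

End grid_surface.

(** * The lower bound *)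

Lemma lee_poweR {R : realType} (r : R) (x y : \bar R) :
  0 <= r -> (0 <= x)%E -> (x <= y)%E -> (x `^ r <= y `^ r)%E.
Proof.
move=> r0 x0 xy; apply: gt0_ler_poweR => //; rewrite in_itv/= ?leey ?andbT//.
exact: le_trans xy.
Qed.

(** * The p-norm on the sphere through its p-th power *)

Section sphere_norm.
Context {R : realType} {d : nat} (p : R).
Hypothesis p1 : 1 <= p.
Implicit Types g h : 'rV[R]_d -> R.

Let p0 : 0 < p. Proof. exact: lt_le_trans p1. Qed.

Definition sphere_pow g : \bar R :=
  (\int[surface_measure d]_(u in sphere d) (`|g u| `^ p)%:E)%E.

Lemma sphere_pow_ge0 g : (0 <= sphere_pow g)%E.
Proof. by apply: integral_ge0 => u _; rewrite lee_fin powR_ge0. Qed.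

Lemma sphere_LnormK g : (sphere_Lnorm p g `^ p = sphere_pow g)%E.
Proof.
rewrite /sphere_Lnorm -poweRrM mulVf ?gt_eqF// poweRe1//.
exact: sphere_pow_ge0.
Qed.

(** |a - b| is at most twice the larger distance to [c]. This crude pointwise bound stands in for
    Minkowski's inequality, at the price of a constant. *)
Lemma powR_normB_le (a b c : R) :
  `|a - b| `^ p <= 2 `^ p * (`|a - c| `^ p + `|b - c| `^ p).
Proof.
wlog ab : a b / `|b - c| <= `|a - c|.
  move=> H; have [|/ltW] := leP `|b - c| `|a - c|; first exact: H.
  by move/H; rewrite (distrC b a) (addrC (`|b - c| `^ p)).
apply: (@le_trans _ _ ((2 * `|a - c|) `^ p)).
  apply: ge0_ler_powR; rewrite ?nnegrE ?mulr_ge0 ?(ltW p0)//.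
  apply: (le_trans (ler_distD c a b)); rewrite (distrC c b); lra.
by rewrite powRM// ler_wpM2l ?powR_ge0// lerDl powR_ge0.
Qed.

Lemma measurable_sphere_pow g : measurable_fun (sphere d) g ->
  measurable_fun (sphere d) (fun u => (`|g u| `^ p)%:E).
Proof.
move=> mg; apply: measurable_fun_EFin.
apply: (measurableT_comp (measurable_powR p)).
exact: measurableT_comp.
Qed.

Lemma sphere_powB_le g1 g2 h :
  measurable_fun (sphere d) g1 -> measurable_fun (sphere d) g2 ->
  measurable_fun (sphere d) h ->
  (sphere_pow (g1 \- g2)%R <=
   (2 `^ p)%:E * (sphere_pow (g1 \- h)%R + sphere_pow (g2 \- h)%R))%E.
Proof.
move=> m1 m2 mh; have mS := @measurable_sphere R d.
have m12 := measurable_funB m1 m2.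
have m1h := measurable_funB m1 mh.
have m2h := measurable_funB m2 mh.
rewrite /sphere_pow -ge0_integralD//; first last.
- exact: measurable_sphere_pow.
- exact: measurable_sphere_pow.
rewrite -ge0_integralZl_EFin//; first last.
- by apply: emeasurable_funD; exact: measurable_sphere_pow.
- by move=> u _; rewrite adde_ge0.
apply: ge0_le_integral => //.
- exact: measurable_sphere_pow.
- apply: measurable_funeM.
  by apply: emeasurable_funD; exact: measurable_sphere_pow.
by move=> u _; rewrite -EFinD -EFinM lee_fin; exact: powR_normB_le.
Qed.

(** If [h] is no farther from [g2] than from [g1], the p-th power of |g1 - g2| is at most 2 * 2^p
    times that of |g1 - h|. This yields the separation premise of [assouad]. *)
Lemma sphere_Lnorm_ge g1 g2 h (k : R) : 0 <= k ->
  measurable_fun (sphere d) g1 -> measurable_fun (sphere d) g2 ->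
  measurable_fun (sphere d) h ->
  ((2 * 2 `^ p * k `^ p)%:E <= sphere_pow (g1 \- g2)%R)%E ->
  (sphere_Lnorm p (g2 \- h)%R <= sphere_Lnorm p (g1 \- h)%R)%E ->
  (k%:E <= sphere_Lnorm p (g1 \- h)%R)%E.
Proof.
move=> k0 m1 m2 mh Hk H.
have H2 : (sphere_pow (g2 \- h)%R <= sphere_pow (g1 \- h)%R)%E.
  rewrite -(sphere_LnormK (g2 \- h)) -(sphere_LnormK (g1 \- h)).
  by apply: (lee_poweR (ltW p0) _ H); exact: poweR_ge0.
have H3 : ((k `^ p)%:E <= sphere_pow (g1 \- h)%R)%E.
  have := le_trans Hk (sphere_powB_le m1 m2 mh).
  move: H2 (sphere_pow_ge0 (g1 \- h)%R) (sphere_pow_ge0 (g2 \- h)%R).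
  case: (sphere_pow (g1 \- h)%R) => [x| |//]; last by rewrite !leey.
  case: (sphere_pow (g2 \- h)%R) => [y| |//] //.
  rewrite -EFinD -EFinM !lee_fin => yx x0 y0.
  have t0 : 0 < 2 `^ p :> R by rewrite powR_gt0.
  rewrite -mulrA mulrCA ler_pM2l//; lra.
rewrite -[k](powRr1 k0) -[X in _ `^ X](mulfV (lt0r_neq0 p0)) powRrM -poweR_EFin.
apply: lee_poweR H3; first by rewrite invr_ge0 ltW.
by rewrite lee_fin powR_ge0.
Qed.

End sphere_norm.

Section spiked_difference.
Context {R : realType} (D m : nat) (r p : R).
Hypotheses (m0 : (0 < m)%N) (r0 : 0 < r) (p1 : 1 <= p).
Local Notation J := {ffun 'I_D -> 'I_m}.
Local Notation eps := (@grid_eps R D m).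
Local Notation gspike := (spike (@grid_dir R D m) eps).
Local Notation gsupport := (spiked_support (@grid_dir R D m) eps r).

Lemma spiked_supportB (t t' : {ffun J -> bool}) u :
  gsupport t u - gsupport t' u = r * \sum_j ((t j)%:R - (t' j)%:R) * gspike j u.
Proof.
rewrite /spiked_support -mulrBr opprD addrACA subrr add0r -sumrB.
by congr (_ * _); apply: eq_bigr => j _; rewrite mulrBl.
Qed.

Lemma measurable_spiked_support (t : {ffun J -> bool}) :
  measurable_fun setT (gsupport t).
Proof.
apply: measurable_funM => //; apply: measurable_funD => //.
apply: measurable_sum => j; apply: measurable_funM => //.
apply: measurable_maxr => //; apply: measurable_funB => //.
by apply: measurable_funM => //; exact: measurable_dotr.
Qed.

(** Each differing spike changes the support function by at least r eps / 2 on its cap, and disjoint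
    caps contribute additively. *)
Lemma sphere_pow_spiked_supportB_ge (t t' : {ffun J -> bool}) :
  (((r * (eps / 2)) `^ p * (cap_const D / m%:R ^+ D) * \sum_j (t j != t' j)%:R)%:E
   <= sphere_pow p (gsupport t \- gsupport t')%R)%E.
Proof.
have eps0 := @grid_eps_gt0 R D m m0.
have disj := @grid_disjoint R D m m0.
have mS := @measurable_sphere R D.+1.
pose q := (r * (eps / 2)) `^ p.
have q0 : 0 <= q by exact: powR_ge0.
pose f j (u : 'rV[R]_D.+1) : \bar R :=
  (q * (t j != t' j)%:R * \1_(grid_cap j) u)%:E.
have f0 j u : (0 <= f j u)%E by rewrite lee_fin !mulr_ge0.
have mf j : measurable_fun (sphere D.+1) (f j).
  apply: measurable_fun_EFin; apply: measurable_funM => //.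
  by apply: measurable_indic; exact: measurable_grid_cap.
apply: (@le_trans _ _
  (\int[surface_measure D.+1]_(u in sphere D.+1) \sum_j f j u)%E).
  rewrite ge0_integral_sum// mulr_sumr -sumEFin; apply: lee_sum => j _.
  rewrite /f; under eq_integral do rewrite EFinM.
  rewrite ge0_integralZl_EFin//; first last.
  - by rewrite mulr_ge0.
  - apply: measurable_fun_EFin.
    by apply: measurable_indic; exact: measurable_grid_cap.
  rewrite integral_indic//; last exact: measurable_grid_cap.
  rewrite setIidl; last by move=> u [].
  rewrite mulrAC EFinM lee_wpmul2l ?lee_fin ?mulr_ge0//.
  exact: surface_grid_cap_ge.
apply: ge0_le_integral => //.
- by move=> u _; apply: sume_ge0.
- by apply: emeasurable_sum.
- apply: measurable_sphere_pow; apply/measurable_funTS.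
  by apply: measurable_funB; exact: measurable_spiked_support.
move=> u Su; rewrite sumEFin lee_fin /= spiked_supportB.
have cap0 j : gspike j u = 0 -> (\1_(grid_cap j) u : R) = 0.
  move=> bj; rewrite indicE memNset// => -[_ /=].
  by rewrite bj leNgt divr_gt0.
have [[-> b0]|[j [bj ->]]] := spike_sumP disj (fun j => (t j)%:R - (t' j)%:R) Su.
  by rewrite big1 ?powR_ge0// => j _; rewrite cap0// mulr0.
rewrite (bigD1 j)//= big1 ?addr0; last first.
  move=> k kj; rewrite cap0 ?mulr0//; apply/eqP.
  rewrite eq_le spike_ge0 andbT leNgt; apply/negP => bk.
  by rewrite (disj _ _ _ Su bk bj) eqxx in kj.
rewrite indicE; case: (boolP (u \in grid_cap j)) => [/set_mem[_ /= cj]|_]; last first.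
  by rewrite mulr0 powR_ge0.
rewrite mulr1; case: (boolP (t j == t' j)) => tt; first by rewrite mulr0 powR_ge0.
rewrite mulr1; apply: ge0_ler_powR; rewrite ?nnegrE//.
- exact: le_trans p1.
- by rewrite mulr_ge0 ?divr_ge0// ltW.
rewrite !normrM (gtr0_norm r0) (gtr0_norm bj) ler_pM2l//.
rewrite (_ : `|_| = 1) ?mul1r//.
by move: tt; case: (t j); case: (t' j); rewrite ?subr0 ?sub0r ?normrN ?normr1.
Qed.

End spiked_difference.

(** * Assouad's lemma for the grid bodies *)

Section minimax_grid.
Context {R : realType} (D m n : nat) (u : nat -> 'rV[R]_D.+1) (p Gamma sigma : R).
Hypotheses (m0 : (0 < m)%N) (uS : forall i, sphere D.+1 (u i)).
Hypotheses (p1 : 1 <= p) (Gamma0 : 0 < Gamma) (sigma0 : 0 < sigma).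
Local Notation J := {ffun 'I_D -> 'I_m}.
Local Notation eps := (@grid_eps R D m).
Local Notation r := (Gamma / 2).
Local Notation gspike := (spike (@grid_dir R D m) eps).
Local Notation gsupport := (spiked_support (@grid_dir R D m) eps r).
Local Notation body := (spiked_ball (@grid_dir R D m) eps r).

Let p0 : 0 < p. Proof. exact: lt_le_trans p1. Qed.
Let r0 : 0 < r. Proof. by rewrite divr_gt0. Qed.
Let eps0 : 0 < eps. Proof. exact: grid_eps_gt0. Qed.
Let disj := @grid_disjoint R D m m0.
Let dirS := @sphere_grid_dir R D m.

(** Solves 2 * 2^p * c^p = [cap_const], which balances [sphere_Lnorm_ge] against the measure of the
    caps. *)
Definition assouad_const : R := (cap_const D / (2 * 2 `^ p)) `^ p^-1.

Lemma assouad_const_gt0 : 0 < assouad_const.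
Proof. by rewrite powR_gt0// divr_gt0 ?cap_const_gt0// mulr_gt0// powR_gt0. Qed.

Lemma grid_body_in_ball t : bodies_in_ball D.+1 Gamma (body t).
Proof.
split; first exact: spiked_ball_convex_body dirS (ltW eps0) r0 disj t.
apply: subset_trans (spiked_ball_sub dirS (ltW eps0) r0 disj (t := t)) _.
move=> x /= /le_trans; apply.
(* With r = Gamma / 2 and eps <= 1, the spikes stay within radius Gamma. *)
have := @grid_eps_le1 R D m m0; move: eps => e e1.
have : r * (1 + e) <= r * 2 by rewrite ler_pM2l//; lra.
lra.
Qed.

Lemma support_grid_body t v : sphere D.+1 v -> support_fun (body t) v = gsupport t v.
Proof. exact: support_spiked_ball. Qed.

Lemma bounded_measurable_support_grid_body t :
  bounded_measurable_on_sphere (support_fun (body t)).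
Proof.
split.
  apply: (@eq_measurable_fun _ _ _ _ _ (gsupport t)).
    by move=> v /set_mem Sv; rewrite support_grid_body.
  by apply/measurable_funTS; exact: measurable_spiked_support.
exists (r * (1 + eps)) => v Sv; rewrite support_grid_body//.
rewrite ger0_norm; last first.
  by apply: le_trans (spiked_support_ge _ _ r0 t v); exact: ltW.
exact: spiked_support_le dirS (ltW eps0) r0 disj t v Sv.
Qed.

Lemma card_grid : #|{: J}| = (m ^ D)%N.
Proof. by rewrite card_ffun !card_ord. Qed.

(** The fraction x = H / m^D lies in [0, 1], so x^p <= x. Hence a loss linear in the Hamming
    distance is dominated by the p-norm distance. *)
Lemma hamming_pow_le (t t' : {ffun J -> bool}) :
  let k := assouad_const * (r * (eps / 2)) / m%:R ^+ D in
  2 * 2 `^ p * (k * \sum_j (t j != t' j)%:R) `^ p <=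
  (r * (eps / 2)) `^ p * (cap_const D / m%:R ^+ D) * \sum_j (t j != t' j)%:R.
Proof.
move=> /=; set H := \sum_j _.
have H0 : 0 <= H by rewrite sumr_ge0.
have mD : 0 < m%:R ^+ D :> R by rewrite exprn_gt0// ltr0n.
have HmD : H / m%:R ^+ D <= 1.
  rewrite ler_pdivrMr// mul1r -natrX -card_grid -sum1_card natr_sum.
  by apply: ler_sum => j _; case: (_ != _).
have H0' : 0 <= H / m%:R ^+ D by rewrite divr_ge0// ltW.
have c0 := assouad_const_gt0.
have : 0 <= r * (eps / 2) by rewrite ltW// mulr_gt0// divr_gt0.
move: (r * (eps / 2)) => re re0.
have -> : (assouad_const * re / m%:R ^+ D * H) `^ p =
    assouad_const `^ p * (re `^ p * (H / m%:R ^+ D) `^ p).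
  rewrite -powRM// -powRM ?(ltW c0)//; last exact: mulr_ge0.
  by congr (_ `^ _); ring.
rewrite /assouad_const -powRrM mulVf ?gt_eqF//.
rewrite powRr1; last by rewrite divr_ge0 ?ltW ?cap_const_gt0// mulr_gt0// powR_gt0.
have Hp : (H / m%:R ^+ D) `^ p <= H / m%:R ^+ D.
  have [->|h] := eqVneq (H / m%:R ^+ D) 0; first by rewrite powR0// gt_eqF.
  by apply: ge1r_powR => //; rewrite lt_def h H0'.
have t0 : 0 < 2 * 2 `^ p :> R by rewrite mulr_gt0// powR_gt0.
have -> : 2 * 2 `^ p * (cap_const D / (2 * 2 `^ p) *
      (re `^ p * (H / m%:R ^+ D) `^ p)) =
    cap_const D * re `^ p * (H / m%:R ^+ D) `^ p.
  by move: (2 * 2 `^ p) t0 => z z0; field; rewrite !gt_eqF.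
have -> : re `^ p * (cap_const D / m%:R ^+ D) * H =
    cap_const D * re `^ p * (H / m%:R ^+ D) by ring.
by rewrite ler_wpM2l// mulr_ge0 ?powR_ge0// ltW// cap_const_gt0.
Qed.

(** One observation informs about at most one spike, so the total over all spikes does not grow with
    their number. *)
Lemma sum_sqr_spike_le v : sphere D.+1 v -> \sum_j gspike j v ^+ 2 <= eps ^+ 2.
Proof.
move=> Sv; under eq_bigr do rewrite expr2.
have [[-> _]|[j [bj ->]]] := spike_sumP disj (fun j => gspike j v) Sv.
  exact: sqr_ge0.
have b := spike_le dirS (ltW eps0) j Sv.
by rewrite -expr2; apply: lerXn2r => //; rewrite nnegrE ltW.
Qed.

(** The hypothesis says that the average information per spike is at most 1/2. The 32 collects 1/2
    from the cap height, 1/8 from [assouad] and 1/2 from the average of exp(-D_j). *)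
Lemma minimax_risk_grid_ge :
  2 * r ^+ 2 * n%:R * eps ^+ 2 / sigma ^+ 2 <= m%:R ^+ D ->
  ((assouad_const * r * eps / 32)%:E <= minimax_risk u sigma n p Gamma)%E.
Proof.
move=> Hn; apply: le_ereal_inf_tmp => _ [hhat [hb hm] <-].
pose th (t : {ffun J -> bool}) : 'rV[R]_n := \row_(i < n) support_fun (body t) (u i).
pose L t y := sphere_Lnorm p (support_fun (body t) \- hhat y).
pose k := assouad_const * (r * (eps / 2)) / m%:R ^+ D.
pose Dl (j : J) := r ^+ 2 * (\sum_(i < n) gspike j (u i) ^+ 2) / sigma ^+ 2.
have mD : 0 < m%:R ^+ D :> R by rewrite exprn_gt0// ltr0n.
have k0 : 0 <= k.
  by rewrite divr_ge0 ?(ltW mD)// !mulr_ge0 ?divr_ge0// ltW// assouad_const_gt0.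
have mL t : measurable_fun setT (L t).
  by apply: hm; exact: bounded_measurable_support_grid_body.
have Lle t t' y : (L t' y <= L t y)%E ->
    ((k * \sum_j (t j != t' j)%:R)%:E <= L t y)%E.
  have [mt _] := bounded_measurable_support_grid_body t.
  have [mt' _] := bounded_measurable_support_grid_body t'.
  have [mh _] := hb y.
  apply: (sphere_Lnorm_ge p1) => //; first by rewrite mulr_ge0// sumr_ge0.
  have -> : sphere_pow p (support_fun (body t) \- support_fun (body t')) =
      sphere_pow p (gsupport t \- gsupport t').
    by apply: eq_integral => v /set_mem Sv /=; rewrite !support_grid_body.
  apply: le_trans (sphere_pow_spiked_supportB_ge m0 r0 p1 t t').
  by rewrite lee_fin; exact: hamming_pow_le.
have DH t j :
    (\sum_i (th t ord0 i - th (flip j t) ord0 i) ^+ 2) / sigma ^+ 2 <= Dl j.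
  rewrite ler_pM2r ?invr_gt0 ?exprn_gt0// mulr_sumr; apply: ler_sum => i _.
  rewrite !mxE !support_grid_body// spiked_supportB exprMn (bigD1 j)//= big1 ?addr0.
    rewrite !ffunE eqxx addbT ler_pM2l ?exprn_gt0// exprMn.
    apply: ler_piMl; first exact: sqr_ge0.
    by case: (t j); rewrite ?subr0 ?sub0r ?sqrrN expr1n.
  by move=> l /negbTE lj; rewrite !ffunE lj addbF subrr mul0r.
have [t Ht] := assouad (lt0r_neq0 sigma0) k0 mL Lle DH.
apply: le_ereal_sup_tmp; exists (risk u p sigma hhat (body t)).
  by exists (body t) => //; exact: grid_body_in_ball.
rewrite /risk; under eq_integral => xi _.
  rewrite (_ : observation u (body t) xi = th t + xi); last first.
    by apply/rowP => i; rewrite !mxE.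
  over.
apply: le_trans Ht; rewrite lee_fin.
(* exp(-x) >= 1 - x reduces the claim to the sum of the [Dl j]; exchanging the sums bounds it
   direction by direction, wherever the [u i] lie. *)
have S : m%:R ^+ D / 2 <= \sum_j expR (- Dl j).
  apply: (@le_trans _ _ (\sum_j (1 - Dl j))); last first.
    by apply: ler_sum => j _; exact: expR_ge1Dx.
  rewrite sumrB sumr_const card_grid natrX.
  suff : \sum_j Dl j <= m%:R ^+ D / 2 by lra.
  rewrite /Dl -mulr_suml -mulr_sumr exchange_big/=.
  apply: (@le_trans _ _ (r ^+ 2 * (n%:R * eps ^+ 2) / sigma ^+ 2)).
    rewrite ler_pM2r ?invr_gt0 ?exprn_gt0// ler_pM2l ?exprn_gt0//.
    rewrite mulr_natl -[X in _ <= _ *+ X](card_ord n) -sumr_const.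
    by apply: ler_sum => i _; exact: sum_sqr_spike_le.
  rewrite ler_pdivlMr//; apply: le_trans Hn; rewrite le_eqVlt; apply/orP; left.
  by apply/eqP; ring.
apply: (@le_trans _ _ (k / 8 * (m%:R ^+ D / 2))).
  rewrite le_eqVlt; apply/orP; left; apply/eqP; rewrite /k; field.
  by rewrite gt_eqF ?ltr0n.
by rewrite ler_wpM2l// divr_ge0.
Qed.

End minimax_grid.

Theorem theoremV1 (R : realType) (d : nat) (u : nat -> 'rV[R]_d)
    (p Gamma sigma : R) :
  (2 <= d)%N ->
  (forall i, sphere d (u i)) ->
  1 <= p -> 0 < Gamma -> 0 < sigma ->
  exists2 c : R, 0 < c &
    forall n : nat, (1 <= n)%N ->
      ((c * sigma `^ (4 / (d%:R + 3)) * Gamma `^ ((d%:R - 1) / (d%:R + 3))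
          * n%:R `^ (- 2 / (d%:R + 3)))%:E
        <= minimax_risk u sigma n p Gamma)%E.
Proof.
case: d u => [//|D] u _ uS p1 Gamma0 sigma0.
set dR : R := D.+1%:R.
have d1 : 1 <= dR by rewrite ler1n.
have d0 : 0 < dR := lt_le_trans ltr01 d1.
have ac0 : 0 < assouad_const D p := assouad_const_gt0 D p.
(* Signal-to-noise factor of the information condition; the added 1 ensures A n >= 1, hence x >= 1
   below. *)
pose A : R := 1 + (2 * (Gamma / 2) ^+ 2 / sigma ^+ 2).
have A1 : 1 <= A.
  by rewrite lerDl divr_ge0 ?sqr_ge0// mulr_ge0// sqr_ge0.
have A0 : 0 < A := lt_le_trans ltr01 A1.
(* The constant must be independent of n only, so dividing by [s] cancels the powers of sigma and
   Gamma. *)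
pose s : R := sigma `^ (4 / (dR + 3)) * Gamma `^ ((dR - 1) / (dR + 3)).
have s0 : 0 < s by rewrite mulr_gt0// powR_gt0.
pose C : R := assouad_const D p * (Gamma / 2) /
  (32 * (64 * dR ^+ 2) * 4 * A `^ (2 / (dR + 3))).
have C0 : 0 < C.
  by rewrite divr_gt0// !mulr_gt0// ?powR_gt0 ?divr_gt0 ?exprn_gt0.
exists (C / s); first exact: divr_gt0.
move=> n n1; rewrite -(mulrA (C / s)) -/s divfK ?gt_eqF//.
have nR1 : 1 <= n%:R :> R by rewrite ler1n.
have An1 : 1 <= A * n%:R by rewrite mulr_ege1.
(* Real solution of x^(d+3) = A n; [m] rounds it up with x <= m <= 2 x. The lower bound serves the
   information condition, the upper one the size of eps. *)
pose x : R := (A * n%:R) `^ (dR + 3)^-1.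
have d30 : 0 < dR + 3 by rewrite addr_gt0.
have x1 : 1 <= x.
  rewrite -(powRr0 (A * n%:R)); apply: ler_powR => //.
  by rewrite invr_ge0 ltW.
pose m := (Num.truncn x).+1.
have xm : x <= m%:R.
  by apply/ltW; have /andP[_] := truncn_itv (le_trans ler01 x1).
have mx : m%:R <= 2 * x.
  have /andP[h _] := truncn_itv (le_trans ler01 x1).
  by rewrite /m -[leLHS]natr1; lra.
have mR0 : 0 < m%:R :> R by rewrite ltr0n.
have x0 : 0 < x := lt_le_trans ltr01 x1.
have xpow : x ^+ (D.+1 + 3) = A * n%:R.
  rewrite -powR_mulrn ?ltW// /x -powRrM natrD mulVf ?gt_eqF//.
  by rewrite powRr1// (le_trans ler01 An1).
have xsq : x ^+ 2 = A `^ (2 / (dR + 3)) * n%:R `^ (2 / (dR + 3)).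
  rewrite -powR_mulrn ?ltW// /x -powRrM [_^-1 * _]mulrC -powRM ?(ltW A0)//.
have Hn : 2 * (Gamma / 2) ^+ 2 * n%:R * grid_eps D m ^+ 2 / sigma ^+ 2 <=
    m%:R ^+ D :> R.
  have h1 : 2 * (Gamma / 2) ^+ 2 / sigma ^+ 2 * n%:R <= m%:R ^+ (D.+1 + 3) :> R.
    apply: (@le_trans _ _ (A * n%:R)); first by rewrite ler_wpM2r// lerDr.
    by rewrite -xpow lerXn2r// nnegrE ltW.
  have h2 : (grid_eps D m : R) ^+ 2 <= m%:R ^- 4.
    rewrite (_ : m%:R ^- 4 = (m%:R ^- 2) ^+ 2); last by rewrite exprVn -exprM.
    apply: lerXn2r.
    - by rewrite nnegrE ltW// grid_eps_gt0.
    - by rewrite nnegrE invr_ge0 exprn_ge0.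
    rewrite lef_pV2 ?posrE ?mulr_gt0 ?exprn_gt0//.
    apply: ler_peMl; first by rewrite exprn_ge0.
    by rewrite mulr_ege1// ?ler1n// exprn_ege1.
  (* A n <= m^(d+3) and eps^2 <= m^-4 leave m^(d-1), the number of spikes. *)
  apply: (@le_trans _ _ (m%:R ^+ (D.+1 + 3) * m%:R ^- 4)).
    rewrite (_ : _ / _ = (2 * (Gamma / 2) ^+ 2 / sigma ^+ 2 * n%:R) *
      grid_eps D m ^+ 2); last by ring.
    apply: ler_pM => //; last exact: sqr_ge0.
    by rewrite mulr_ge0// divr_ge0 ?sqr_ge0// mulr_ge0 ?sqr_ge0.
  by rewrite addnC -addSnnS exprD mulrAC divff ?mul1r// expf_neq0// gt_eqF.
have m0 : (0 < m)%N by [].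
apply: (le_trans _ (minimax_risk_grid_ge m0 uS p1 Gamma0 sigma0 Hn)).
rewrite lee_fin mulNr powRN /C.
(* [C] was chosen so that its bound is the grid bound with eps evaluated at 2 x in place of m; m <=
   2 x then finishes. *)
have -> : assouad_const D p * (Gamma / 2) /
    (32 * (64 * dR ^+ 2) * 4 * A `^ (2 / (dR + 3))) / n%:R `^ (2 / (dR + 3)) =
  assouad_const D p * (Gamma / 2) * (64 * dR ^+ 2 * (4 * x ^+ 2))^-1 / 32.
  have nR0 : 0 < n%:R :> R := lt_le_trans ltr01 nR1.
  by rewrite xsq; field; rewrite !gt_eqF ?powR_gt0.
rewrite ler_pM2r// ler_pM2l ?mulr_gt0 ?divr_gt0//.
rewrite lef_pV2 ?posrE ?mulr_gt0 ?exprn_gt0// ler_pM2l ?mulr_gt0 ?exprn_gt0//.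
have -> : 4 * x ^+ 2 = (2 * x) ^+ 2 by ring.
by rewrite lerXn2r// nnegrE ?mulr_ge0// ltW.
Qed.
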